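(* Let $\mu\in\mathscr W$. Define $h^+(\mu)$ as the infimum of all $h\in\mathbb R$ for which there exist constants $c(h),c'(h)>0$ and $\rho=\rho(h)>0$ such that $$\mu\big(x\stackrel{\geqslant h}{\longleftrightarrow}y\big)\le c(h)\,e^{-c'(h)|x-y|^{\rho}}\quad\text{for all }x,y\in\mathbb Z^d.$$ Then $h^+(\mu)<\infty$.
   Context: **Graph.** Let $d\ge3$ and let $\Gamma\subset\mathbb Z^d$ be finite with $0\notin\Gamma$, $\Gamma=-\Gamma$, such that every $x\in\mathbb Z^d$ is a finite sum of elements of $\Gamma$. Let $\mathscr E=\{(x,x+y):x\in\mathbb Z^d,y\in\Gamma\}$ (oriented edges), $\mathcal G=(\mathbb Z^d,\mathscr E)$, $|x-y|$ the graph distance of $\mathcal G$, and $B(x,L)=\{y:|y-x|\le L\}$. For $e=(x,y)\in\mathscr E$ write $x(e)=x$. For $\Lambda\subset\mathbb Z^d$, $\Lambda^c=\mathbb Z^d\setminus\Lambda$, $\partial\Lambda=\{z\in\Lambda^c:\exists x\in\Lambda,(x,z)\in\mathscr E\}$, and $\mathcal G_\Lambda$ is the graph with vertex set $\Lambda\cup\partial\Lambda$ and edge set $\mathscr E_\Lambda$, the edges of $\mathscr E$ with at least one endpoint in $\Lambda$. **Gibbs measures.** $\Omega=\mathbb R^{\mathbb Z^d}$ with product $\sigma$-algebra and coordinates $\varphi_x$; $\nabla\varphi(e)=\varphi_y-\varphi_x$ for $e=(x,y)$. Let $\mathcal B=\{B(x,1):x\in\mathbb Z^d\}$ and for $X=B(x,1)$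 let $\mathscr E(X)=\{e\in\mathscr E:x(e)=x\}$. A family of potentials $\{V_X\}_{X\in\mathcal B}$, $V_X:\mathbb R^{\mathscr E(X)}\to\mathbb R_+$, is required to satisfy, for some $c_0\in[1,\infty)$ and $\alpha>0$: (smoothness) $V_X\in C^{2,\alpha}$ (twice continuously differentiable with $\alpha$-Hölder second derivatives); (symmetry) $V_X(\eta)=V_X(-\eta)$; (translation invariance) $V_{X+a}((\nabla\varphi(e))_{e\in\mathscr E(X+a)})=V_X((\nabla\varphi(e+a))_{e\in\mathscr E(X)})$ for $a\in\mathbb Z^d$, where $e+a=(x+a,y+a)$ for $e=(x,y)$; (uniform convexity) with $\partial^2_{x,y}=\partial^2/\partial\varphi_x\partial\varphi_y$, $c_0^{-1}\le-\sum_{X\in\mathcal B:X\supset\{x,y\}}\partial^2_{x,y}V_X((\nabla\varphi(e))_{e\in\mathscr E(X)})\le c_0$ for $(x,y)\in\mathscr E$, and $\partial^2_{x,y}V_X((\nabla\varphi(e))_{e\in\mathscr E(X)})=0$ for $x\ne y$ with $(x,y)\notin\mathscr E$. For finite $\Lambda$ let $H_\Lambda(\varphi)=\sum_{X\in\mathcal B:X\cap\Lambda\neq\emptyset}V_X((\nabla\varphi(e))_{e\in\mathscr E(X)})$, and let $\mu_\Lambda^0$ be the probability measure on $\Omega$ under which $\varphi=0$ on $\Lambda^c$ and $(\varphi_x)_{x\in\Lambda}$ has density proportional to $e^{-H_\Lambda(\varphi)}$ (with $\varphi=0$ on $\Lambda^c$) with respect to Lebesgue measure on $\mathbb R^\Lambda$.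 $\mathscr W$ is the set of probability measures $\mu$ on $\Omega$ for which there is an increasing sequence of finite sets $\Lambda_n$ with union $\mathbb Z^d$, with all $\mathcal G_{\Lambda_n}$ connected, such that $\mu^0_{\Lambda_n}\to\mu$ weakly, for some family of potentials $\{V_X\}_{X\in\mathcal B}$, $V_X:\mathbb R^{\mathscr E(X)}\to\mathbb R_+$, satisfying the conditions (smoothness), (symmetry), (translation invariance) and (uniform convexity) with constants $c_0$ and $\alpha$. **Connection event.** $E^{\geqslant h}=\{x\in\mathbb Z^d:\varphi_x\ge h\}$, and $\{x\stackrel{\geqslant h}{\longleftrightarrow}y\}$ is the event that $E^{\geqslant h}$ contains a nearest-neighbor path in $\mathcal G$ containing both $x$ and $y$. *)

(* Defs.v *)
From HB Require Import structures.
From mathcomp Require Import all_boot all_order all_algebra finmap.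
From mathcomp Require Import all_classical all_reals all_analysis.

Set Implicit Arguments.
Unset Strict Implicit.
Unset Printing Implicit Defensive.

Import Order.TTheory GRing.Theory Num.Theory.
Import numFieldNormedType.Exports.

Local Open Scope classical_set_scope.
Local Open Scope ring_scope.

Notation lattice d := 'rV[int]_d.

Section graph.
Context {d : nat} (G : {fset lattice d}).

Definition admissible_steps : Prop :=
  [/\ 0 \notin G,
      forall y, y \in G -> - y \in G
    & forall x : lattice d, exists2 s : seq (lattice d),
        {subset s <= G} & x = \sum_(y <- s) y].

Definition edge : rel (lattice d) := fun x z => z - x \in G.

Definition walk (n : nat) (x y : lattice d) : Prop :=
  exists p, [/\ path edge x p, last x p = y & size p = n].

(* The default value 0 is used only if no walk joins x and y, which
   [admissible_steps] excludes. *)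
Definition gdist (x y : lattice d) : nat :=
  xget 0%N [set n | walk n x y /\ forall m, walk m x y -> (n <= m)%N].

Definition gball (x : lattice d) (L : nat) : set (lattice d) :=
  [set y | (gdist y x <= L)%N].

Definition boundary (A : {fset lattice d}) : set (lattice d) :=
  [set z | z \notin A /\ exists2 x, x \in A & edge x z].

Definition inner_edge (A : {fset lattice d}) : rel (lattice d) :=
  fun x z => edge x z && ((x \in A) || (z \in A)).

Definition inner_connected (A : {fset lattice d}) : Prop :=
  forall x y, ([set` A] `|` boundary A) x -> ([set` A] `|` boundary A) y ->
  exists2 p, path (inner_edge A) x p & last x p = y.

(* The edges with starting point x, listed through an enumeration of G, so that
   functions on this set of edges are row vectors of size #|` G|. *)
Definition out_edge (x : lattice d) (j : 'I_#|` G|) : lattice d * lattice d :=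
  (x, x + nth 0 G j).

Definition eshift (e : lattice d * lattice d) (a : lattice d) :=
  (e.1 + a, e.2 + a).

End graph.

Section field_space.
Context (R : realType) (d : nat).

Definition coordinate_events : set (set (lattice d -> R)) :=
  \bigcup_(x in [set: lattice d])
    preimage_set_system setT (fun phi : lattice d -> R => phi x) measurable.

(* The type [lattice d -> R] with the product sigma-algebra. *)
Definition Omega := g_sigma_algebraType coordinate_events.

Definition grad (phi : lattice d -> R) (e : lattice d * lattice d) : R :=
  phi e.2 - phi e.1.

Definition pderiv (F : (lattice d -> R) -> R) (x : lattice d)
    (phi : lattice d -> R) : R :=
  derive1 (fun t : R => F (fun z => if z == x then t else phi z)) (phi x).

End field_space.

HB.instance Definition _ (R : realType) (d : nat) :=
  Measurable.on (Omega R d).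

Section power_measure.
Context {disp : measure_display} {T : measurableType disp} {R : realType}.
Context (m1 : {sigma_finite_measure set T -> \bar R}).
Local Open Scope ereal_scope.

Definition tcons n (u : T * n.-tuple T) : n.+1.-tuple T :=
  [the n.+1.-tuple _ of u.1 :: u.2].

Lemma measurable_tcons n : measurable_fun setT (@tcons n).
Proof.
by apply: measurable_cons; [exact: measurable_fst|exact: measurable_snd].
Qed.

Definition tuncons n (v : n.+1.-tuple T) : T * n.-tuple T :=
  (tnth v ord0, [tuple of behead v]).

Lemma measurable_tuncons n : measurable_fun setT (@tuncons n).
Proof.
apply/measurable_fun_pair; first exact: measurable_tnth.
exact: measurable_behead.
Qed.

Lemma tconsK n : cancel (@tcons n) (@tuncons n).
Proof.
by move=> [t v]; rewrite /tuncons; congr pair; apply/val_inj.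
Qed.

Section cons_measure.
Context n (m : {sigma_finite_measure set (n.-tuple T) -> \bar R}).

Definition cons_measure : set (n.+1.-tuple T) -> \bar R :=
  pushforward (m1 \x m) (@tcons n).

Let cons_measure0 : cons_measure set0 = 0.
Proof. by rewrite /cons_measure /pushforward preimage_set0 measure0. Qed.

Let cons_measure_ge0 A : 0 <= cons_measure A.
Proof. by rewrite /cons_measure /pushforward measure_ge0. Qed.

Let cons_measure_sigma_additive : semi_sigma_additive cons_measure.
Proof.
have mf := @measurable_tcons n.
move=> F mF tF mUF; rewrite /cons_measure /pushforward preimage_bigcup.
apply: measure_semi_sigma_additive.
- by move=> k; rewrite -[X in measurable X]setTI; exact: mf.
- apply/trivIsetP => /= i j _ _ ij; rewrite -preimage_setI.
  by move/trivIsetP : tF => /(_ _ _ _ _ ij) ->//; rewrite preimage_set0.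
- by rewrite -preimage_bigcup -[X in measurable X]setTI; exact: mf.
Qed.

HB.instance Definition _ := isMeasure.Build _ _ _ cons_measure
  cons_measure0 cons_measure_ge0 cons_measure_sigma_additive.

Let cons_measure_sigma_finite : sigma_finite setT cons_measure.
Proof.
have /sigma_finiteP[F [FT ndF Foo]] := sigma_finiteT m1.
have /sigma_finiteP[H [HT ndH Hoo]] := sigma_finiteT m.
exists (fun k => @tuncons n @^-1` (F k `*` H k)).
  rewrite -preimage_bigcup -[LHS](preimage_setT (@tuncons n)); congr (_ @^-1` _).
  rewrite -setXTT FT HT predeqE => -[x y]; split.
    move=> [/= [k _ Fkx] [l _ Hly]]; exists (maxn k l) => //; split.
    - by move: x Fkx; exact/subsetPset/ndF/leq_maxl.
    - by move: y Hly; exact/subsetPset/ndH/leq_maxr.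
  by move=> [k _ []/= ? ?]; split; exists k.
move=> k; have [mF Fk] := Foo k; have [mH Hk] := Hoo k; split.
  rewrite -[X in measurable X]setTI; apply: measurable_tuncons => //.
  exact: measurableX.
rewrite /cons_measure /pushforward -comp_preimage.
have -> : @tuncons n \o @tcons n = id.
  by apply/funext => u /=; rewrite tconsK.
by rewrite preimage_id product_measure1E// lte_mul_pinfty// ge0_fin_numE.
Qed.

HB.instance Definition _ := Measure_isSigmaFinite.Build _ _ _ cons_measure
  cons_measure_sigma_finite.

End cons_measure.

Fixpoint power_measure n : {sigma_finite_measure set (n.-tuple T) -> \bar R} :=
  match n with
  | 0%N => [the {sigma_finite_measure set (0.-tuple T) -> \bar R} of
             @dirac _ (0.-tuple T) [tuple] R]
  | k.+1 => [the {sigma_finite_measure set (k.+1.-tuple T) -> \bar R} of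
             cons_measure (power_measure k)]
  end.

End power_measure.

(* Lebesgue measure on R^n; [measurableTypeR R] is R with its Borel
   sigma-algebra. *)
Definition lebesgue_tuple (R : realType) (n : nat) :
    {sigma_finite_measure set (n.-tuple (measurableTypeR R)) -> \bar R} :=
  power_measure (@lebesgue_measure R) n.

Section smoothness.
Context {R : realType} {n : nat}.

Definition partial (j : 'I_n) (f : 'rV[R]_n -> R) : 'rV[R]_n -> R :=
  fun eta => 'D_(delta_mx 0 j) f eta.

Definition C2_holder (alpha : R) (f : 'rV[R]_n -> R) : Prop :=
  [/\ forall eta, differentiable f eta,
      forall j eta, differentiable (partial j f) eta,
      forall i j, continuous (partial i (partial j f))
    & exists K : R, forall i j eta zeta,
        `|partial i (partial j f) eta - partial i (partial j f) zeta|
          <= K * `|eta - zeta| `^ alpha].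

End smoothness.

Section gibbs.
Context {R : realType} {d : nat} (G : {fset lattice d}).

(* [V x] stands for the potential V_X with X = [gball G x 1]; as G is finite,
   x |-> [gball G x 1] is injective, so indexing by x is indexing by X. *)
Definition potentials := lattice d -> 'rV[R]_#|` G| -> R.

Implicit Types (V : potentials) (A : {fset lattice d}) (x y : lattice d).

Definition out_grad (phi : lattice d -> R) x : 'rV[R]_#|` G| :=
  \row_j grad phi (out_edge x j).

Definition energy V x (phi : lattice d -> R) : R := V x (out_grad phi x).

Definition uniformly_convex V (c0 : R) : Prop :=
  forall phi : lattice d -> R,
  (forall x y, edge G x y ->
     c0^-1 <= - (\sum_(z \in [set z | [set x; y] `<=` gball G z 1])
                  pderiv (pderiv (energy V z) y) x phi) <= c0) /\
  (forall z x y, x != y -> ~~ edge G x y ->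
     pderiv (pderiv (energy V z) y) x phi = 0).

Definition admissible_potentials (c0 alpha : R) V : Prop :=
  [/\ forall x eta, 0 <= V x eta,
      forall x, C2_holder alpha (V x),
      forall x eta, V x eta = V x (- eta),
      forall x a phi, V (x + a) (out_grad phi (x + a)) =
                      V x (\row_j grad phi (eshift (out_edge x j) a))
    & uniformly_convex V c0].

Definition hamiltonian V A (phi : lattice d -> R) : R :=
  \sum_(x \in [set x | gball G x 1 `&` [set` A] !=set0]) energy V x phi.

Definition extend0 A (v : #|` A|.-tuple (measurableTypeR R)) : Omega R d :=
  fun x => if x \in A then nth 0 v (index x A) else 0.

Definition is_gibbs V A (P : probability (Omega R d) R) : Prop :=
  exists2 C : R, 0 < C &
    forall E : set (Omega R d), measurable E ->
      P E = (C%:E * \int[lebesgue_tuple R #|` A|]_(v in @extend0 A @^-1` E)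
                      (expR (- hamiltonian V A (extend0 v)))%:E)%E.

Definition weak_cvg (P : nat -> probability (Omega R d) R)
    (Q : probability (Omega R d) R) : Prop :=
  forall f : {ptws lattice d -> R} -> R, continuous f ->
    (exists M : R, forall phi, `|f phi| <= M) ->
    (\int[P n]_phi (f phi)%:E)%E @[n --> \oo] --> (\int[Q]_phi (f phi)%:E)%E.

Definition gibbs_class (c0 alpha : R) (mu : probability (Omega R d) R) : Prop :=
  exists2 V, admissible_potentials c0 alpha V &
  exists (A : nat -> {fset lattice d}) (P : nat -> probability (Omega R d) R),
    [/\ forall n, (A n `<=` A n.+1)%fset,
        forall x, exists n, x \in A n,
        forall n, inner_connected G (A n),
        forall n, is_gibbs V (A n) (P n)
      & weak_cvg P mu].

Definition connected_above (h : R) x y : set (Omega R d) :=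
  [set phi | exists z p, [/\ path (edge G) z p,
     forall w, w \in z :: p -> h <= phi w, x \in z :: p & y \in z :: p]].

Definition h_plus (mu : probability (Omega R d) R) : \bar R :=
  ereal_inf [set h%:E | h in [set h : R |
    exists c c' rho : R, [/\ 0 < c, 0 < c', 0 < rho &
      forall x y, (mu (connected_above h x y) <=
        (c * expR (- (c' * (gdist G x y)%:R `^ rho)))%:E)%E]]].

End gibbs.

(* Main.v *)
Require Import Defs.
From HB Require Import structures.
From mathcomp Require Import all_boot all_order all_algebra finmap.
From mathcomp Require Import all_classical all_reals all_analysis.
From mathcomp Require Import measurable_realfun.
From mathcomp Require Import ring lra zify.

(** The idea is to balance the exponential moments of the field against the
entropy of a coarse description of paths.

Exponential moments.  By uniform convexity the Hessian of H = [hamiltonian V A]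
is the Laplacian of a network with conductances at least 1/c0, hence
H(phi + u) + H(phi - u) - 2 H(phi) is at least (2 c0)^-1 times the Dirichlet
energy of u ([hamiltonian_convex]).  For a linear functional S of the field,
apply the Prekopa-Leindler inequality to exp(S - H), exp(- S - H) and
exp(- H): as H is even, the first two have the same integral, and the mean of
exp S is at most exp(B / 2), where B bounds 2 S(u) minus the second difference
of H in the direction u ([exponential_moment]).

Trace inequality.  If S sums the field over a finite family of points with at
most 2^k of them in any ball of radius 8^k, then B is at most a constant times
the number of points ([trace_inequality]).  Indeed, u is the telescoping sum of
the differences of its averages over boxes of side 8^k.  Such a difference
displaces a mass of density at most 2^k 8^(- d k) over a distance of order
8^k; by Cauchy-Schwarz its square costs at most 2^k 8^(2 k - d k) times the energy and
the number of points, and this is summable because d >= 3.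

Entropy.  A path from x that reaches distance of order 8^n contains 2^n points
which are the leaves of a binary tree whose branches at height k have length of
order 8^k; these leaves are sparse in the above sense ([trees_cover],
[trees_sparse]).  A branch at height k is chosen among at most C 8^(d k)
possibilities and there are 2^(n - k) of them, so that there are at most b^(2^n)
trees for some constant b ([size_trees_le]).

The sum of the field over 2^n leaves above level h is at least h 2^n, and this
has probability at most exp((C - h) 2^n) for the limit measure as well, because
only finitely many coordinates are involved ([weak_tail]).  A union bound over
the trees gives b^(2^n) exp((C - h) 2^n), which is at most exp(- 2^n) for h
large; as 2^n is the cube root of 8^n, the connection probability decays like a
stretched exponential with rho = 1/3. *)

Set Implicit Arguments.
Unset Strict Implicit.
Unset Printing Implicit Defensive.
Import Order.TTheory GRing.Theory Num.Theory.
Import numFieldNormedType.Exports.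
Local Open Scope classical_set_scope.
Local Open Scope ring_scope.

(** * The Prekopa-Leindler inequality on the line *)

Section line.
Context {R : realType}.
Notation T := (measurableTypeR R).
Notation mu := (@lebesgue_measure R).
Implicit Types A B S : set T.

(** The midpoint of z' and b is z exactly when z' = [homothety b z]; preimages
under this map are therefore midpoint sets. *)
Definition homothety (b z : R) : R := z *+ 2 - b.

Lemma measurable_homothety b : measurable_fun setT (homothety b : T -> T).
Proof.
apply: measurable_funB => //.
rewrite (_ : (fun x => x *+ 2) = (fun x : T => (2%:R * x)%R : T)); last first.
  by apply/funext => x; rewrite mulr_natl.
exact: mulrl_measurable.
Qed.

Lemma lebesgue_measure_homothety (b : R) A : measurable A ->
  (2%:E * mu (homothety b @^-1` A))%E = mu A.
Proof.
move=> mA.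
rewrite [RHS](@lebesgue_measure_unique R (mscale (NngNum (ler0n R 2))
  (measure_function_pushforward__canonical__measure_function_Measure mu
    (measurable_homothety b))))//.
move=> _ [[x y] _ <-]; rewrite /= /mscale /= /pushforward /=.
rewrite [X in (_ * mu X)%E](_ : _ = `](x + b) / 2, (y + b) / 2]%classic); last first.
  apply/seteqP; split => z /=; rewrite /homothety !in_itv /= => /andP[? ?];
    apply/andP; split; lra.
rewrite !lebesgue_measure_itv /= !lte_fin.
case: ifPn => xy; case: ifPn => xy'; rewrite ?mule0 //.
- by rewrite -EFinM -!EFinB; congr (_%:E); lra.
- by exfalso; move: xy'; rewrite -leNgt; lra.
- by exfalso; move: xy; rewrite -leNgt; lra.
Qed.

(** The one-dimensional Brunn-Minkowski inequality in midpoint form.  The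
midpoints of A with min B and those of B with max A lie on the two sides of the
midpoint of max A and min B, so they overlap in at most one point. *)
Lemma compact_midpoint A B S :
    A !=set0 -> B !=set0 -> compact (A : set R) -> compact (B : set R) ->
    measurable S -> (forall x y, A x -> B y -> S ((x + y) / 2)) ->
  (mu A + mu B <= 2%:E * mu S)%E.
Proof.
move=> A0 B0 cA cB mS AB.
have [a] := @compact_EVT_max R R id A A0 cA (continuous_subspaceT (fun _ => cvg_id)).
rewrite inE => Aa amax.
have [b] := @compact_EVT_min R R id B B0 cB (continuous_subspaceT (fun _ => cvg_id)).
rewrite inE => Bb bmin.
have mA : measurable A := compact_measurable cA.
have mB : measurable B := compact_measurable cB.
pose A' := homothety b @^-1` A.
pose B' := homothety a @^-1` B.
have mA' : measurable A' by rewrite -[A']setTI; exact: measurable_homothety.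
have mB' : measurable B' by rewrite -[B']setTI; exact: measurable_homothety.
pose c : T := (a + b) / 2.
have A'S : A' `|` B' `<=` S.
  move=> z [] /= Hz.
    by have := AB _ _ Hz Bb; rewrite (_ : _ / 2 = z)// /homothety; lra.
  by have := AB _ _ Aa Hz; rewrite (_ : _ / 2 = z)// /homothety; lra.
have mc : measurable [set c] by exact: measurable_set1.
(* A point of A' is at most c, and a point of B' is at least c. *)
have dis : A' `&` (B' `\` [set c]) = set0.
  apply/seteqP; split => // z [/= zA [zB zc]].
  apply: zc => /=; rewrite /c.
  have := amax _ (mem_set zA); have := bmin _ (mem_set zB); rewrite /= /homothety; lra.
have mB'c : mu (B' `\` [set c]) = mu B'.
  apply/eqP; rewrite eq_le le_measure ?inE //=; last exact: measurableD.
  rewrite -[leRHS]adde0 -[X in (_ + X)%E](@lebesgue_measure_set1 R c).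
  apply: le_trans (measureU2 _ _ _) => //; last exact: measurableD.
  apply: le_measure; rewrite ?inE//.
    by apply: measurableU => //; exact: measurableD.
  by move=> z Bz; have [->|zc] := eqVneq z c; [right|left; split => //; exact/eqP].
rewrite -(lebesgue_measure_homothety b mA) -(lebesgue_measure_homothety a mB).
rewrite -ge0_muleDr// lee_pmul2l//.
rewrite -/A' -/B' -mB'c -measureU//; last exact: measurableD.
apply: le_measure; rewrite ?inE//; first by apply: measurableU => //; exact: measurableD.
by apply: subset_trans A'S; apply: setUS; exact: subDsetl.
Qed.

Lemma compact_lt_pinfty A : compact (A : set R) -> (mu A < +oo)%E.
Proof. by move=> cA; exact: compact_finite_measure. Qed.

(** Inner regularity reduces the measurable case to the compact one. *)
Lemma midpoint_measure A B S :
    A !=set0 -> B !=set0 -> measurable A -> measurable B ->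
    measurable S -> (forall x y, A x -> B y -> S ((x + y) / 2)) ->
  (mu A + mu B <= 2%:E * mu S)%E.
Proof.
move=> [a0 A0] [b0 B0] mA mB mS AB.
have [/eqP muS|muS] := eqVneq (mu S) +oo%E.
  by move/eqP: muS => ->; rewrite gt0_muley// ?leey// lte_fin.
have Sfin : (2%:E * mu S)%E \is a fin_num.
  rewrite fin_numM// ge0_fin_numE// ltey//.
have main K J : compact (K : set R) -> compact (J : set R) -> K `<=` A -> J `<=` B ->
    (mu K + mu J <= 2%:E * mu S)%E.
  move=> cK cJ KA JB.
  have h (A1 K1 : set R) x : A1 x -> K1 `<=` A1 -> compact K1 ->
      exists K2, [/\ (mu K1 <= mu K2)%E, compact K2, K2 `<=` A1 & K2 !=set0].
    move=> Ax KA1 cK1; have [->|/set0P K10] := eqVneq K1 set0.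
      exists [set x]; split; [by rewrite measure0|exact: compact_set1| |by exists x].
      by move=> _ ->.
    by exists K1.
  (* An empty compact set is replaced by a point. *)
  have [K2 [le1 c1 s1 n1]] := h A K a0 A0 KA cK.
  have [J2 [le2 c2 s2 n2]] := h B J b0 B0 JB cJ.
  apply: le_trans (leeD le1 le2) _.
  apply: compact_midpoint => // x y Kx Jy; apply: AB; [exact: s1|exact: s2].
have step1 J : compact (J : set R) -> J `<=` B -> (mu A + mu J <= 2%:E * mu S)%E.
  move=> cJ JB.
  have Jfin : mu J \is a fin_num by rewrite ge0_fin_numE//; exact: compact_lt_pinfty.
  rewrite -leeBrDr// (lebesgue_regularity_inner_sup mA).
  apply: ge_ereal_sup => _ [K [cK KA] <-].
  by rewrite leeBrDr//; exact: main.
have Afin : mu A \is a fin_num.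
  rewrite ge0_fin_numE//; have := @step1 set0 (@compact0 _) (@sub0set _ _).
  by rewrite measure0 adde0 => /le_lt_trans; apply; rewrite -ge0_fin_numE// mule_ge0.
rewrite addeC -leeBrDr// (lebesgue_regularity_inner_sup mB).
apply: ge_ereal_sup => _ [K [cK KA] <-].
by rewrite leeBrDr// addeC; exact: step1.
Qed.

(** Tonelli for the region below the graph of f. *)
Lemma layer_cake (f : T -> R) : measurable_fun setT f -> (forall x, 0 <= f x) ->
  (\int[mu]_x (f x)%:E = \int[mu]_(t in `]0%R, +oo[) mu [set x | (t < f x)%R])%E.
Proof.
move=> mf f0.
pose D : set (T * T) := [set z | (0 < z.2) && (z.2 < f z.1)].
have mD : measurable D.
  have m2 : measurable_fun setT (fun z : T * T => (0 < z.2) && (z.2 < f z.1)).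
    by apply: measurable_and; apply: measurable_fun_ltr => //;
       apply: measurableT_comp.
  by have := m2 measurableT [set true] I; rewrite setTI.
have mF : measurable_fun setT (fun z => (\1_D z : R)%:E).
  exact/measurable_EFinP/measurable_indic.
transitivity (\int[mu]_x \int[mu]_t (\1_D (x, t) : R)%:E)%E.
  apply: eq_integral => x _.
  rewrite (_ : (fun t => _) = (fun t => (\1_(`]0, f x[%classic : set T) t : R)%:E)).
    rewrite integral_indic// setIT; apply/esym/(etrans (lebesgue_measure_itv `]0, f x[)).
    rewrite /= lte_fin.
    by case: ltP => [_|x0]; [rewrite sube0|rewrite (@le_anti _ _ (f x) 0) ?f0 ?x0].
  by apply/funext => t; rewrite !indicE; congr ((_ : bool)%:R%:E); apply/idP/idP;
    rewrite !inE /= in_itv.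
rewrite (fubini_tonelli _ mF)//.
rewrite [RHS]integral_mkcond; apply: eq_integral => t _.
rewrite patchE; have [t0|t0] := ltP 0 t.
  rewrite mem_set; last by rewrite /= in_itv/= t0.
  rewrite (_ : (fun x => _) = (fun x => (\1_([set x | t < f x] : set T) x : R)%:E)).
    rewrite integral_indic ?setIT//.
    by have := measurable_fun_ltr (@measurable_cst _ _ T _ setT (t : T)) mf measurableT (Y := [set true]) I; rewrite setTI.
  by apply/funext => x; rewrite !indicE; congr ((_ : bool)%:R%:E); apply/idP/idP;
    rewrite !inE /D /= t0.
rewrite memNset; last by rewrite /= in_itv/= andbT => /(le_lt_trans t0); rewrite ltxx.
rewrite integral0_eq// => x _; rewrite indicE memNset//= => /andP[].
by move=> /(le_lt_trans t0); rewrite ltxx.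
Qed.

(** When f and g both have supremum 1, their superlevel sets at a level t < 1 are
nonempty, and the superlevel set of h contains all their midpoints; it remains to
integrate [midpoint_measure] over t. *)
Lemma prekopa_leindler_normalized (f g h : T -> R) :
    measurable_fun setT f -> measurable_fun setT g -> measurable_fun setT h ->
    (forall x, 0 <= f x <= 1) -> (forall x, 0 <= g x <= 1) ->
    (forall x, 0 <= h x) ->
    (forall t, t < 1 -> exists x, t < f x) -> (forall t, t < 1 -> exists x, t < g x) ->
    (forall x y, f x * g y <= h ((x + y) / 2) ^+ 2) ->
  (\int[mu]_x (f x)%:E + \int[mu]_x (g x)%:E <= 2%:E * \int[mu]_x (h x)%:E)%E.
Proof.
move=> mf mg mh f01 g01 h0 fsup gsup fgh.
have f0 x : 0 <= f x by case/andP: (f01 x).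
have g0 x : 0 <= g x by case/andP: (g01 x).
have mlt (k : T -> R) (mk : measurable_fun setT k) (t : R) : measurable ([set x | t < k x] : set T).
  by have := measurable_fun_ltr (@measurable_cst _ _ T _ setT (t : T)) mk measurableT (Y := [set true]) I; rewrite setTI.
have mmu (k : T -> R) : measurable_fun setT k ->
    measurable_fun setT (fun t : T => mu [set x : T | t < k x]).
  move=> mk.
  have m2 : measurable_fun setT (fun z : T * T => z.2 < k z.1).
    by apply: measurable_fun_ltr => //; apply: measurableT_comp.
  have mD : measurable [set z : T * T | z.2 < k z.1].
    by have := m2 measurableT [set true] I; rewrite setTI.
  have := measurable_fun_ysection mu mD.
  rewrite (_ : mu \o _ = (fun t => mu [set x | t < k x]))//.
  apply/funext => t /=; congr (mu _); apply/seteqP; split => x /=.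
    by rewrite /ysection/= inE.
  by rewrite /ysection/= inE.
rewrite !layer_cake// -ge0_integralZl//; last exact: measurable_funTS (mmu _ mh).
rewrite -ge0_integralD//; try exact: measurable_funTS (mmu _ _).
apply: ge0_le_integral => //.
- by move=> t _; rewrite adde_ge0.
- by apply: emeasurable_funD; exact: measurable_funTS (mmu _ _).
- by apply: measurable_funeM; exact: measurable_funTS (mmu _ mh).
move=> t /=; rewrite in_itv/= andbT => t0.
have [t1|t1] := ltP t 1.
  apply: midpoint_measure; [exact: fsup|exact: gsup|exact: mlt|exact: mlt|exact: mlt|].
  move=> x y /= tx ty; rewrite -(@ltr_pXn2r _ 2) ?nnegrE ?(ltW t0)//.
  by apply: lt_le_trans (fgh x y); rewrite expr2 ltr_pM// ltW.
have k0 (k : T -> R) : (forall x, 0 <= k x <= 1) -> mu [set x | t < k x] = 0%E.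
  move=> k01; rewrite (_ : [set x | _] = set0) ?measure0//.
  apply/seteqP; split => // x /= /(le_lt_trans t1).
  by case/andP: (k01 x) => _ /le_lt_trans h1 /h1; rewrite ltxx.
by rewrite (k0 f f01) (k0 g g01) adde0 mule_ge0.
Qed.


(** Dividing f, g and h by sup f, sup g and sqrt (sup f * sup g) reduces to the
normalized case; the arithmetic mean then dominates the geometric one. *)
Lemma prekopa_leindler_bounded (f g h : T -> R) (M : R) :
    measurable_fun setT f -> measurable_fun setT g -> measurable_fun setT h ->
    (forall x, 0 <= f x <= M) -> (forall x, 0 <= g x <= M) ->
    (forall x, 0 <= h x) ->
    (forall x y, f x * g y <= h ((x + y) / 2) ^+ 2) ->
  ((\int[mu]_x (f x)%:E) * (\int[mu]_x (g x)%:E) <=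
   (\int[mu]_x (h x)%:E) * (\int[mu]_x (h x)%:E))%E.
Proof.
move=> mf mg mh fM gM h0 fgh.
have bnd (k : T -> R) : (forall x, 0 <= k x <= M) ->
    (forall x, k x = 0) \/
    exists2 a : R, 0 < a & (forall x, 0 <= k x / a <= 1) /\
      (forall t, t < 1 -> exists x, t < k x / a).
  move=> kM; have k0 x : 0 <= k x by case/andP: (kM x).
  have hs : has_sup (range k).
    split; first by exists (k 0); exists 0.
    by exists M => _ [x _ <-]; case/andP: (kM x).
  have ksup x : k x <= sup (range k) by apply: ub_le_sup; [case: hs|exists x].
  have : 0 <= sup (range k) by apply: le_trans (ksup 0).
  rewrite le_eqVlt => /predU1P[a0|a0]; [left|right].
    by move=> x; apply/le_anti; rewrite k0 a0 ksup.
  exists (sup (range k)) => //; split=> [x|t t1].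
    by rewrite divr_ge0 ?(ltW a0)//= ler_pdivrMr// mul1r.
  have [|_ [x _ <-] tx] := @sup_adherent _ (range k) ((1 - t) * sup (range k)) _ hs.
    by rewrite mulr_gt0// subr_gt0.
  by exists x; rewrite ltr_pdivlMr//; move: tx; rewrite mulrBl mul1r opprB addrC subrK.
have [f0|[a a0 [fa1 fasup]]] := bnd f fM.
  rewrite [X in (X * _)%E](_ : _ = 0%E); last by apply: integral0_eq => x _; rewrite f0.
  by rewrite mul0e mule_ge0// integral_ge0// => x _; rewrite lee_fin.
have [g0|[b b0 [gb1 gbsup]]] := bnd g gM.
  rewrite [X in (_ * X <= _)%E](_ : _ = 0%E); last by apply: integral0_eq => x _; rewrite g0.
  by rewrite mule0 mule_ge0// integral_ge0// => x _; rewrite lee_fin.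
pose c := Num.sqrt (a * b).
have c0 : 0 < c by rewrite sqrtr_gt0 mulr_gt0.
have c2 : c ^+ 2 = a * b by rewrite sqr_sqrtr// mulr_ge0// ltW.
have := @prekopa_leindler_normalized (fun x => f x / a) (fun x => g x / b) (fun x => h x / c).
move=> /(_ _ _ _ fa1 gb1 _ fasup gbsup).
have mZ (k : T -> R) (z : R) : measurable_fun setT k -> measurable_fun setT (fun x => k x / z).
  by move=> mk; apply: measurable_funM.
move=> /(_ (mZ _ _ mf) (mZ _ _ mg) (mZ _ _ mh)).
have hc x : 0 <= h x / c by rewrite divr_ge0// ltW.
move=> /(_ hc) PL.
have {}PL : (\int[mu]_x (f x / a)%:E + \int[mu]_x (g x / b)%:E <=
   2%:E * \int[mu]_x (h x / c)%:E)%E.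
  apply: PL => x y.
  by rewrite mulrACA expr_div_n c2 -invfM ler_pM2r// invr_gt0 mulr_gt0.
have iZ (k : T -> R) (z : R) : 0 < z -> measurable_fun setT k -> (forall x, 0 <= k x) ->
    (\int[mu]_x (k x / z)%:E = z^-1%:E * \int[mu]_x (k x)%:E)%E.
  move=> z0 mk k0; rewrite -ge0_integralZl//.
  - by apply: eq_integral => x _; rewrite -EFinM mulrC.
  - exact/measurable_EFinP.
  - by move=> x _; rewrite lee_fin.
  - by rewrite lee_fin invr_ge0 ltW.
have f0 x : 0 <= f x by case/andP: (fM x).
have g0 x : 0 <= g x by case/andP: (gM x).
move: PL; rewrite !iZ//.
have : (0 <= \int[mu]_x (f x)%:E)%E by apply: integral_ge0 => x _; rewrite lee_fin.
have : (0 <= \int[mu]_x (g x)%:E)%E by apply: integral_ge0 => x _; rewrite lee_fin.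
have : (0 <= \int[mu]_x (h x)%:E)%E by apply: integral_ge0 => x _; rewrite lee_fin.
move: (\int[mu]_x (f x)%:E)%E (\int[mu]_x (g x)%:E)%E (\int[mu]_x (h x)%:E)%E.
move=> [F||] [G||] [H||] //; rewrite ?lee_fin => H0 G0 F0.
all: rewrite ?mulyy ?leey//.
all: rewrite ?(gt0_muley (x := a^-1%:E)) ?(gt0_muley (x := b^-1%:E)) ?lte_fin ?invr_gt0//.
move=> PL; suff : F * G <= H * H by [].
have PL2 : b * F + a * G <= 2 * (c * H).
  have -> : b * F + a * G = (a * b) * (a^-1 * F + b^-1 * G) by field; rewrite !gt_eqF.
  have -> : 2 * (c * H) = (a * b) * (2 * (c^-1 * H)).
    by rewrite -c2; field; rewrite gt_eqF.
  by rewrite ler_pM2l// mulr_gt0.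
have sq : (b * F + a * G) ^+ 2 <= (2 * (c * H)) ^+ 2.
  by rewrite ler_sqr ?nnegrE// ?addr_ge0// ?mulr_ge0// ltW.
rewrite -(@ler_pM2l _ (4 * (a * b))) ?mulr_gt0//.
apply: (@le_trans _ _ ((b * F + a * G) ^+ 2)); last first.
  by apply: (le_trans sq); rewrite !exprMn c2; nra.
have := sqr_ge0 (b * F - a * G); nra.
Qed.

(** Infinite values have to be allowed because marginals of functions of several
variables may be infinite.  The hypothesis survives truncation of the three
functions at the same height. *)
Lemma prekopa_leindler_line (f g h : T -> \bar R) :
    measurable_fun setT f -> measurable_fun setT g -> measurable_fun setT h ->
    (forall x, 0 <= f x)%E -> (forall x, 0 <= g x)%E -> (forall x, 0 <= h x)%E ->
    (forall x y, (f x * g y <= h ((x + y) / 2)%R * h ((x + y) / 2)%R)%E) ->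
  ((\int[mu]_x f x) * (\int[mu]_x g x) <= (\int[mu]_x h x) * (\int[mu]_x h x))%E.
Proof.
move=> mf mg mh f0 g0 h0 fgh.
pose tr (k : T -> \bar R) (N : nat) x : R := fine (mine (k x) N%:R%:E).
have trfin k N x : (0 <= k x)%E -> (tr k N x)%:E = mine (k x) N%:R%:E.
  move=> k0; rewrite fineK// ge0_fin_numE; last by rewrite le_min k0 lee_fin ler0n.
  by rewrite gt_min ltry orbT.
have tr0 k N x : (0 <= k x)%E -> 0 <= tr k N x <= N%:R.
  move=> k0; rewrite -!lee_fin trfin// le_min k0 lee_fin ler0n/=.
  by rewrite ge_min lexx orbT.
have mtr k N : measurable_fun setT k -> measurable_fun setT (tr k N).
  move=> mk; apply: (@measurableT_comp _ _ _ _ _ _ fine); first (by apply: (@fine_measurable R setT measurableT)).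
  exact: measurable_mine.
have cvgtr k : measurable_fun setT k -> (forall x, 0 <= k x)%E ->
    (\int[mu]_x (tr k N x)%:E @[N --> \oo] --> \int[mu]_x k x)%E.
  move=> mk k0.
  have : (\int[mu]_x (tr k N x)%:E @[N --> \oo] --> \int[mu]_x limn (fun N => (tr k N x)%:E))%E.
    apply: cvg_monotone_convergence => //.
    - by move=> N; apply/measurable_EFinP; exact: mtr.
    - by move=> N x _; rewrite lee_fin; case/andP: (tr0 k N x (k0 x)).
    - move=> x _ m n mn; rewrite !trfin// le_min !ge_min lexx/= lee_fin ler_nat mn.
      by rewrite orbT.
  rewrite (_ : (fun x => limn _) = k)//; apply/funext => x.
  apply/cvg_lim => //; under eq_fun do rewrite trfin//.
  move: (k x) (k0 x) => [r| |]// r0.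
    apply: cvg_near_cst; near=> N; apply/min_idPl; rewrite lee_fin.
    near: N; exact: nbhs_infty_ger.
  under eq_fun do rewrite minye.
  exact/cvgeryP/cvgr_idn.
have fin N : (\int[mu]_x (tr f N x)%:E * \int[mu]_x (tr g N x)%:E <=
   \int[mu]_x (tr h N x)%:E * \int[mu]_x (tr h N x)%:E)%E.
  apply: (@prekopa_leindler_bounded _ _ _ N%:R); try exact: mtr.
  - by move=> x; exact: tr0.
  - by move=> x; exact: tr0.
  - by move=> x; case/andP: (tr0 h N x (h0 x)).
  move=> x y; set z := (x + y) / 2.
  rewrite -lee_fin expr2 !EFinM !trfin//.
  have m0 (k : T -> \bar R) w : (0 <= k w)%E -> (0 <= mine (k w) N%:R%:E)%E.
    by move=> k0; rewrite le_min k0 lee_fin ler0n.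
  have [hz|hz] := leP (h z) N%:R%:E.
    by apply: le_trans (fgh x y); apply: lee_pmul; rewrite ?m0// ge_min lexx.
  by apply: lee_pmul; rewrite ?m0// ge_min lexx orbT.
have fin' N : (\int[mu]_x (tr f N x)%:E * \int[mu]_x (tr g N x)%:E <=
   \int[mu]_x h x * \int[mu]_x h x)%E.
  have hN : (\int[mu]_x (tr h N x)%:E <= \int[mu]_x h x)%E.
    apply: ge0_le_integral => //.
    - by move=> x _; rewrite lee_fin; case/andP: (tr0 h N x (h0 x)).
    - by apply/measurable_EFinP; exact: mtr.
    - by move=> x _; rewrite trfin// ge_min lexx.
  apply: (le_trans (fin N)); apply: lee_pmul => //; apply: integral_ge0 => x _;
    by rewrite lee_fin; case/andP: (tr0 h N x (h0 x)).
have [->|fg0] := eqVneq (\int[mu]_x f x * \int[mu]_x g x)%E 0%E.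
  by rewrite mule_ge0// integral_ge0.
apply: (cvge_le _ (cvgeM (neq0_mule_def fg0) (cvgtr f mf f0) (cvgtr g mg g0))).
by apply: nearW => N; exact: fin'.
Unshelve. all: by end_near. Qed.

End line.

(** * The Prekopa-Leindler inequality on tuples *)

Section tuples.
Context {R : realType}.
Notation T := (measurableTypeR R).
Notation mu := (@lebesgue_measure R).
Notation lebn := (@lebesgue_tuple R).

Definition tmidpoint n (u v : n.-tuple R) : n.-tuple R :=
  [tuple (tnth u i + tnth v i) / 2 | i < n].

Definition topp n (u : n.-tuple R) : n.-tuple R := [tuple - tnth u i | i < n].

Lemma tmidpoint_tcons n (s t : T) (u v : n.-tuple T) :
  tmidpoint (tcons (s, u)) (tcons (t, v)) = tcons ((s + t) / 2, tmidpoint u v).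
Proof.
apply: eq_from_tnth => i; rewrite tnth_mktuple.
have [j ->|->] := unliftP ord0 i; last by rewrite !tnth0.
by rewrite !tnthS tnth_mktuple.
Qed.

Lemma topp_tcons n (s : T) (u : n.-tuple T) :
  topp (tcons (s, u)) = tcons (- s, topp u).
Proof.
apply: eq_from_tnth => i; rewrite tnth_mktuple.
have [j ->|->] := unliftP ord0 i; last by rewrite !tnth0.
by rewrite !tnthS tnth_mktuple.
Qed.

Lemma integral_lebesgue_tuple0 (f : 0.-tuple T -> \bar R) :
  measurable_fun setT f -> (\int[lebn 0]_x f x = f [tuple])%E.
Proof.
by move=> mf; rewrite /lebesgue_tuple/= integral_dirac// diracE mem_set// mul1e.
Qed.

(** Tonelli for the first coordinate; this is the induction step for all results
on [lebesgue_tuple]. *)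
Lemma integral_lebesgue_tupleS n (f : n.+1.-tuple T -> \bar R) :
  measurable_fun setT f -> (forall x, 0 <= f x)%E ->
  (\int[lebn n.+1]_x f x = \int[mu]_s \int[lebn n]_u f (tcons (s, u)))%E.
Proof.
move=> mf f0.
have mtc := @measurable_tcons _ T n.
transitivity (\int[mu \x lebn n]_z f (tcons z))%E.
  by rewrite /lebesgue_tuple/= ge0_integral_pushforward.
by rewrite (fubini_tonelli1 _ (measurableT_comp mf mtc))// => z; exact: f0.
Qed.

Lemma measurable_slice n (f : n.+1.-tuple T -> \bar R) (s : T) :
  measurable_fun setT f -> measurable_fun setT (fun u => f (tcons (s, u))).
Proof.
move=> mf; apply: (measurableT_comp mf).
exact: (@measurable_fun_pair2 _ _ _ _ _ _ (@tcons _ T n) s (@measurable_tcons _ T n)).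
Qed.

Lemma measurable_marginal n (f : n.+1.-tuple T -> \bar R) :
  measurable_fun setT f -> (forall x, 0 <= f x)%E ->
  measurable_fun setT (fun s => \int[lebn n]_u f (tcons (s, u)))%E.
Proof.
move=> mf f0.
by apply: (measurable_fun_fubini_tonelli_F _ (measurableT_comp mf (@measurable_tcons _ T n))) => z; exact: f0.
Qed.

(** Induction on the dimension: for fixed first coordinates the inequality in one
dimension less says that the marginals satisfy the hypothesis on the line. *)
Lemma prekopa_leindler n (f g h : n.-tuple T -> \bar R) :
    measurable_fun setT f -> measurable_fun setT g -> measurable_fun setT h ->
    (forall x, 0 <= f x)%E -> (forall x, 0 <= g x)%E -> (forall x, 0 <= h x)%E ->
    (forall x y, f x * g y <= h (tmidpoint x y) * h (tmidpoint x y))%E ->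
  ((\int[lebn n]_x f x) * (\int[lebn n]_x g x) <=
   (\int[lebn n]_x h x) * (\int[lebn n]_x h x))%E.
Proof.
elim: n f g h => [|n IH] f g h mf mg mh f0 g0 h0 fgh.
  rewrite !integral_lebesgue_tuple0//.
  by have := fgh [tuple] [tuple]; rewrite [tmidpoint _ _]tuple0.
rewrite !integral_lebesgue_tupleS//.
apply: prekopa_leindler_line.
- exact: measurable_marginal.
- exact: measurable_marginal.
- exact: measurable_marginal.
- by move=> x; apply: integral_ge0.
- by move=> x; apply: integral_ge0.
- by move=> x; apply: integral_ge0.
move=> s t; apply: IH => //; try exact: measurable_slice.
by move=> u v; have := fgh (tcons (s, u)) (tcons (t, v)); rewrite tmidpoint_tcons.
Qed.

Lemma integral_lebesgue_tupleN n (f : n.-tuple T -> \bar R) :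
    measurable_fun setT f -> (forall x, 0 <= f x)%E ->
  (\int[lebn n]_x f (topp x) = \int[lebn n]_x f x)%E.
Proof.
elim: n f => [|n IH] f mf f0.
  by apply: eq_integral => x _; rewrite [topp x]tuple0 [x]tuple0.
have mN : measurable_fun setT (@topp n.+1 : n.+1.-tuple T -> n.+1.-tuple T).
  apply/measurable_fun_tnthP => i.
  rewrite (_ : _ \o _ = (fun x : n.+1.-tuple T => - (tnth x i : R))%R); last first.
    by apply/funext => x /=; rewrite tnth_mktuple.
  by apply: measurable_funN; exact: measurable_tnth.
rewrite !integral_lebesgue_tupleS//; last exact: measurableT_comp.
under eq_integral => s _.
  under eq_integral do rewrite topp_tcons.
  rewrite (IH (fun u => f (tcons (- s, u))))//; last exact: measurable_slice.
  over.
have mF := measurable_marginal mf f0.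
have mopp : measurable_fun setT (-%R : T -> T) by exact: oppr_measurable.
transitivity (\int[pushforward mu (-%R : T -> T)]_s
    \int[lebn n]_u f (tcons (s, u)))%E.
  by rewrite ge0_integral_pushforward// => y _; exact: integral_ge0.
by apply: eq_measure_integral => A mA _; exact: lebesgue_measureN.
Qed.

End tuples.

(** * Walks and balls of the graph *)

Section graph_facts.
Context {d : nat} (G : {fset lattice d}).
Implicit Types (x y z : lattice d) (s : seq (lattice d)).

Lemma path_steps x s : all (mem G) s ->
  exists p, [/\ path (edge G) x p, last x p = x + \sum_(y <- s) y & size p = size s].
Proof.
elim: s x => [|g s IH] x /=; first by exists [::]; rewrite big_nil addr0.
case/andP=> gG /(IH (x + g))[p [pp lp sp]]; exists (x + g :: p); split => /=.
- by rewrite pp /edge addrAC subrr add0r gG.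
- by rewrite lp big_cons addrA.
- by rewrite sp.
Qed.

Lemma steps_path x p : path (edge G) x p ->
  exists s, [/\ all (mem G) s, size s = size p & last x p = x + \sum_(y <- s) y].
Proof.
elim: p x => [|y p IH] x /=; first by exists [::]; rewrite big_nil addr0.
case/andP=> xy /IH[s [sG ss ls]]; exists (y - x :: s); split => /=.
- by rewrite sG andbT.
- by rewrite ss.
- by rewrite ls big_cons addrA subrKC.
Qed.

Lemma walk_steps n x y :
  walk G n x y <-> exists s, [/\ all (mem G) s, size s = n & y - x = \sum_(z <- s) z].
Proof.
split=> [[p [/steps_path[s [sG ss ls]] lp sp]]|[s [sG <- yx]]].
  by exists s; split=> //; [rewrite ss|rewrite -lp ls addrAC subrr add0r].
have [p [pp lp sp]] := path_steps x sG.
by exists p; split=> //; rewrite lp -yx subrKC.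
Qed.

(** [gdist] picks a minimal length only among existing ones, so it has to be shown
that some length is minimal as soon as a walk exists. *)
Lemma gdistP x y n : walk G n x y ->
  walk G (gdist G x y) x y /\ (gdist G x y <= n)%N.
Proof.
move=> w.
have [m wm mmin] : exists2 m, walk G m x y & forall k, walk G k x y -> (m <= k)%N.
  have ex : exists m, `[< walk G m x y >] by exists n; apply/asboolP.
  case: (ex_minnP ex) => m /asboolP wm mmin; exists m => // k wk.
  by apply: mmin; apply/asboolP.
have [w' min'] := @xgetPex _ 0%N [set n | walk G n x y /\ forall m, walk G m x y -> (n <= m)%N]
  (ex_intro _ m (conj wm mmin)).
by split => //; apply: min'.
Qed.

Hypothesis admG : admissible_steps G.

Lemma walk_exists x y : exists n, walk G n x y.
Proof.
case: admG => _ _ /(_ (y - x))[s sG yx].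
by exists (size s); apply/walk_steps; exists s; split => //; apply/allP.
Qed.

Lemma gball1P z x : gball G z 1 x <-> x = z \/ z - x \in G.
Proof.
rewrite /gball /=; split=> [le1|[->|zx]].
- have [n /gdistP[w _]] := walk_exists x z.
  case/walk_steps: w => s [sG ss zx]; rewrite -ss in le1.
  case: s sG le1 zx {ss} => [|g [|//]] sG _ zx.
    by left; apply/esym/eqP; rewrite -subr_eq0 zx big_nil.
  by right; rewrite zx big_seq1; move: sG; rewrite /= andbT.
- have /gdistP[_ /leq_trans] : walk G 0 z z; last exact.
  by apply/walk_steps; exists [::]; rewrite big_nil subrr.
- have /gdistP[_] : walk G 1 x z; last by [].
  by apply/walk_steps; exists [:: z - x]; rewrite big_seq1 /= zx.
Qed.

End graph_facts.

(** * Second differences along a line *)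

Section calculus.
Context {R : realType} {n : nat}.
Implicit Types (F : 'rV[R]_n -> R) (eta delta : 'rV[R]_n).

(** The differential is linear, so the derivative in the direction delta is the
combination of the partial derivatives with the entries of delta. *)
Lemma is_derive_line F eta delta (t : R) :
  (forall x, differentiable F x) ->
  is_derive t 1 (fun s => F (eta + s *: delta))
    (\sum_j delta 0 j * partial j F (eta + t *: delta)).
Proof.
move=> dF.
set x := eta + t *: delta.
have quot : (fun h : R => h^-1 *: (((fun s : R => F (eta + s *: delta)) \o shift t) (h *: 1) -
      F (eta + t *: delta))) =
    (fun h : R => h^-1 *: ((F \o shift x) (h *: delta) - F x)).
  apply/funext => h /=; congr (_ *: (F _ - _)).
  rewrite (_ : h *: 1 + t = h + t); last by rewrite /GRing.scale /= mulr1.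
  by rewrite /x scalerDl addrCA.
have dx : derivable F x delta by exact: diff_derivable.
have vx : 'D_delta F x = \sum_j delta 0 j * partial j F x.
  rewrite deriveE// {1}[delta]row_sum_delta linear_sum /=; apply: eq_bigr => j _.
  by rewrite linearZ /= /partial deriveE.
split; first by rewrite /derivable quot.
by rewrite /derive quot -vx.
Qed.

(** The function s |-> k s + k (- s) - q s^2 has derivative
k1 s - k1 (- s) - 2 q s, which is nonnegative for s > 0 by the mean value theorem. *)
Lemma second_difference_ge (k k1 k2 : R -> R) (q : R) :
    (forall t : R, is_derive t 1 k (k1 t)) -> (forall t : R, is_derive t 1 k1 (k2 t)) ->
    (forall t, q <= k2 t) ->
  q <= k 1 + k (- 1) - 2 * k 0.
Proof.
move=> dk dk1 k2q.
pose m (s : R) := k s + k (- s) - q * s ^+ 2.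
pose m1 (s : R) := k1 s - k1 (- s) - q * (2 * s).
have dkN (f f1 : R -> R) : (forall t : R, is_derive t 1 f (f1 t)) ->
    forall s : R, is_derive s 1 (fun s => f (- s)) (- f1 (- s)).
  move=> df s; rewrite -mulrN1.
  exact: (@is_derive1_comp R f -%R s _ _ (df (- s)) (is_deriveNid s 1)).
have dm (s : R) : is_derive s 1 m (m1 s).
  have ? := dkN _ _ dk s.
  apply: is_derive_eq; rewrite /m1 /GRing.scale/=; ring.
have dcont (f f1 : R -> R) (a b : R) : (forall t : R, is_derive t 1 f (f1 t)) ->
    {within `[a, b], continuous f}.
  by move=> df; apply: derivable_within_continuous => x _; case: (df x).
have [c] : exists2 c, c \in `]0, 1[%R & m 1 - m 0 = m1 c * (1 - 0).
  by apply: MVT => //; exact: dcont dm.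
rewrite in_itv/= => /andP[c0 c1] mc.
have [e] : exists2 e, e \in `](- c), c[%R & k1 c - k1 (- c) = k2 e * (c - (- c)).
  by apply: MVT => //; [lra|exact: dcont dk1].
move=> _ k1c.
have : 0 <= m1 c by have := k2q e; rewrite /m1 k1c; nra.
move: mc; rewrite /m oppr0 expr0n/= expr1n; lra.
Qed.

End calculus.

(** * Second derivatives of the energy *)

(** A quadratic form whose matrix a has vanishing row and column sums is a
weighted sum of squared differences: expand (u x - u y)^2 and note that the
terms in u x ^ 2 and u y ^ 2 vanish. *)
Lemma quadratic_form_laplacian (R : realFieldType) (T : Type) (n : nat) (B : seq T)
    (u : T -> R) (c : T -> 'I_n -> R) (p : 'I_n -> 'I_n -> R) :
    (forall j, \sum_(x <- B) c x j = 0) ->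
  \sum_j (\sum_(x <- B) u x * c x j) * \sum_i (\sum_(x <- B) u x * c x i) * p i j =
  - (2^-1) * \sum_(x <- B) \sum_(y <- B) (u x - u y) ^+ 2 *
     \sum_j c y j * \sum_i c x i * p i j.
Proof.
move=> c0; pose a x y := \sum_j c y j * \sum_i c x i * p i j.
have S1 x : \sum_(y <- B) a x y = 0.
  rewrite exchange_big /= big1// => j _.
  by rewrite -mulr_suml c0 mul0r.
have S2 y : \sum_(x <- B) a x y = 0.
  rewrite exchange_big /= big1// => j _.
  rewrite -mulr_sumr exchange_big /= big1 ?mulr0// => i _.
  by rewrite -mulr_suml c0 mul0r.
have -> : \sum_j (\sum_(x <- B) u x * c x j) * \sum_i (\sum_(x <- B) u x * c x i) * p i j =
    \sum_(x <- B) \sum_(y <- B) u x * u y * a x y.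
  transitivity (\sum_(x <- B) \sum_(y <- B) \sum_j u x * u y * (c y j * \sum_i c x i * p i j)).
    rewrite exchange_big /=; under [RHS]eq_bigr do rewrite exchange_big /=.
    rewrite [RHS]exchange_big /=; apply: eq_bigr => j _.
    rewrite big_distrl /=; apply: eq_bigr => y _.
    under eq_bigr do rewrite big_distrl /=.
    rewrite exchange_big /= big_distrr /=; apply: eq_bigr => x _.
    rewrite !mulr_sumr; apply: eq_bigr => i _; ring.
  by do 2 (apply: eq_bigr => ? _); rewrite -mulr_sumr.
rewrite -/(a _ _).
under [in RHS]eq_bigr do under eq_bigr do rewrite -/(a _ _).
have -> : \sum_(x <- B) \sum_(y <- B) (u x - u y) ^+ 2 * a x y =
   \sum_(x <- B) u x ^+ 2 * \sum_(y <- B) a x y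
   + \sum_(y <- B) u y ^+ 2 * \sum_(x <- B) a x y
   - 2 * \sum_(x <- B) \sum_(y <- B) u x * u y * a x y.
  under [X in _ + X - _]eq_bigr do rewrite mulr_sumr.
  rewrite [X in _ + X - _]exchange_big /= mulr_sumr -big_split /= -sumrB.
  apply: eq_bigr => x _.
  rewrite !mulr_sumr -big_split /= -sumrB; apply: eq_bigr => y _; ring.
have -> : \sum_(x <- B) u x ^+ 2 * \sum_(y <- B) a x y = 0.
  by rewrite big1// => x _; rewrite S1 mulr0.
have -> : \sum_(y <- B) u y ^+ 2 * \sum_(x <- B) a x y = 0.
  by rewrite big1// => y _; rewrite S2 mulr0.
by field.
Qed.

Lemma ler_sum_uniq_subset (R : numDomainType) (T : eqType) (s t : seq T) (f : T -> R) :
  uniq s -> uniq t -> {subset s <= t} -> (forall x, 0 <= f x) ->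
  \sum_(x <- s) f x <= \sum_(x <- t) f x.
Proof.
move=> us ut st f0.
have ps : perm_eq s [seq x <- t | x \in s].
  apply: uniq_perm => //; first exact: filter_uniq.
  by move=> x; rewrite mem_filter; case: (boolP (x \in s)) => // /st ->.
rewrite (perm_big _ ps) /= big_filter big_mkcond /=.
by apply: ler_sum => x _; case: ifP.
Qed.

Lemma is_derive_bigsum (R : realType) (I : Type) (s : seq I) (f df : I -> R -> R) (t : R) :
  (forall i, is_derive t 1 (f i) (df i t)) ->
  is_derive t 1 (fun r => \sum_(i <- s) f i r) (\sum_(i <- s) df i t).
Proof.
move=> dfi; elim: s => [|i s IH].
  rewrite big_nil (_ : (fun r => _) = cst 0); first exact: is_derive_cst.
  by apply/funext => r; rewrite big_nil.
rewrite big_cons (_ : (fun r => _) = f i \+ (fun r => \sum_(i <- s) f i r)).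
  exact: is_deriveD.
by apply/funext => r; rewrite big_cons.
Qed.

Section hessian.
Context {R : realType} {d : nat} (G : {fset lattice d}).
Implicit Types (V : potentials (R := R) G) (x y z : lattice d) (phi psi u : lattice d -> R).

Definition bump y : lattice d -> R := fun w => (w == y)%:R.

Notation inc y z := (out_grad G (bump y) z).

Lemma out_gradD phi psi z : out_grad G (phi \+ psi) z = out_grad G phi z + out_grad G psi z.
Proof. by apply/rowP => j; rewrite !mxE /grad /=; ring. Qed.

Lemma out_gradZ (c : R) phi z : out_grad G (fun w => c * phi w) z = c *: out_grad G phi z.
Proof. by apply/rowP => j; rewrite !mxE /grad /=; ring. Qed.

Lemma out_grad_set phi y z (t : R) :
  out_grad G (fun w => if w == y then t else phi w) z =
  (out_grad G phi z - phi y *: inc y z) + t *: inc y z.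
Proof.
apply/rowP => j; rewrite !mxE /grad /bump /=.
by case: eqVneq => [->|_]; case: eqVneq => [->|_] /=; ring.
Qed.

Lemma is_derive_line_sum (n : nat) (I : Type) (s : seq I) (c : I -> R) (F : I -> 'rV[R]_n -> R)
    (eta delta : 'rV[R]_n) (t : R) :
  (forall i eta, differentiable (F i) eta) ->
  is_derive t 1 (fun r => \sum_(i <- s) c i * F i (eta + r *: delta))
    (\sum_(i <- s) c i * \sum_j delta 0 j * partial j (F i) (eta + t *: delta)).
Proof.
move=> dF; apply: (@is_derive_bigsum R I s (fun i r => c i * F i (eta + r *: delta))
  (fun i t => c i * \sum_j delta 0 j * partial j (F i) (eta + t *: delta))) => i.
by apply: is_deriveZ; exact: is_derive_line.
Qed.

Lemma pderiv_sum_grad (I : Type) (s : seq I) (c : I -> R) (F : I -> 'rV[R]_#|` G| -> R) y z phi :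
  (forall i eta, differentiable (F i) eta) ->
  pderiv (fun psi => \sum_(i <- s) c i * F i (out_grad G psi z)) y phi =
  \sum_(i <- s) c i * \sum_j inc y z 0 j * partial j (F i) (out_grad G phi z).
Proof.
move=> dF; rewrite /pderiv derive1E.
under eq_fun do (under eq_bigr do rewrite out_grad_set).
have := is_derive_line_sum s c (out_grad G phi z - phi y *: inc y z) (inc y z) (phi y) dF.
by rewrite subrK => /@derive_val ->.
Qed.

(** By the chain rule this is the second derivative of [energy V z] in phi_x and
phi_y, see [pderiv2_energy]. *)
Definition mixed_partial V z x y phi : R :=
  \sum_j inc y z 0 j * \sum_i inc x z 0 i *
    partial i (partial j (V z)) (out_grad G phi z).

Lemma pderiv2_energy V z x y phi :
  (forall eta, differentiable (V z) eta) ->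
  (forall j eta, differentiable (partial j (V z)) eta) ->
  pderiv (pderiv (energy V z) y) x phi = mixed_partial V z x y phi.
Proof.
move=> dV ddV; rewrite (_ : pderiv (energy V z) y =
    fun psi => \sum_j inc y z 0 j * partial j (V z) (out_grad G psi z)).
  exact: pderiv_sum_grad.
apply/funext => psi; rewrite (_ : energy V z =
    fun psi => \sum_(i <- [:: tt]) 1 * V z (out_grad G psi z)).
  by rewrite (pderiv_sum_grad [:: tt] (fun=> 1) (F := fun=> V z))// big_seq1 mul1r.
by apply/funext => ?; rewrite big_seq1 mul1r.
Qed.

(** The second derivative of [energy V z] at phi in the direction u. *)
Definition second_derivative V z phi u : R :=
  \sum_j out_grad G u z 0 j * \sum_i out_grad G u z 0 i *
    partial i (partial j (V z)) (out_grad G phi z).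

Lemma second_difference_energy V (s : seq (lattice d)) phi u (q : R) :
    (forall z eta, differentiable (V z) eta) ->
    (forall z j eta, differentiable (partial j (V z)) eta) ->
    (forall psi, q <= \sum_(z <- s) second_derivative V z psi u) ->
  q <= \sum_(z <- s) energy V z (phi \+ u) + \sum_(z <- s) energy V z (phi \- u) -
     2 * \sum_(z <- s) energy V z phi.
Proof.
move=> dV ddV hq.
pose ps t w := phi w + t * u w.
have og t z : out_grad G (ps t) z = out_grad G phi z + t *: out_grad G u z.
  by rewrite -out_gradZ -out_gradD.
pose k t := \sum_(z <- s) V z (out_grad G phi z + t *: out_grad G u z).
pose k1 t := \sum_(z <- s) \sum_j out_grad G u z 0 j *
  partial j (V z) (out_grad G phi z + t *: out_grad G u z).
pose k2 t := \sum_(z <- s) second_derivative V z (ps t) u.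
have -> : \sum_(z <- s) energy V z (phi \+ u) = k 1.
  by apply: eq_bigr => z _; rewrite /energy -og; congr (V z (out_grad G _ z));
    apply/funext => w; rewrite /ps/= mul1r.
have -> : \sum_(z <- s) energy V z (phi \- u) = k (-1).
  by apply: eq_bigr => z _; rewrite /energy -og; congr (V z (out_grad G _ z));
    apply/funext => w; rewrite /ps/= mulN1r.
have -> : \sum_(z <- s) energy V z phi = k 0.
  by apply: eq_bigr => z _; rewrite /energy -og; congr (V z (out_grad G _ z));
    apply/funext => w; rewrite /ps/= mul0r addr0.
apply: (@second_difference_ge R k k1 k2) => [t|t|t]; last exact: hq.
  apply: (@is_derive_bigsum R _ s (fun z t => V z (out_grad G phi z + t *: out_grad G u z))
    (fun z t => \sum_j out_grad G u z 0 j *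
      partial j (V z) (out_grad G phi z + t *: out_grad G u z))) => z.
  exact: is_derive_line.
apply: (@is_derive_bigsum R _ s (fun z t => \sum_j out_grad G u z 0 j *
      partial j (V z) (out_grad G phi z + t *: out_grad G u z))
    (fun z t => second_derivative V z (ps t) u)) => z.
by rewrite /second_derivative og; exact: is_derive_line_sum.
Qed.

Lemma bump_sum (B : seq (lattice d)) u w : uniq B -> w \in B ->
  \sum_(x <- B) u x * bump x w = u w.
Proof.
move=> uB wB; rewrite (bigD1_seq w)//= big1 => [|x xw].
  by rewrite /bump eqxx mulr1 addr0.
by rewrite /bump eq_sym (negbTE xw) mulr0.
Qed.

(** The energy only depends on increments, hence is invariant under the addition
of a constant to phi: the matrix of its mixed derivatives has vanishing row and
column sums. *)
Lemma second_derivative_laplacian V z phi u (B : seq (lattice d)) :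
    uniq B -> z \in B -> (forall g, g \in G -> z + g \in B) ->
  second_derivative V z phi u = - (2^-1) * \sum_(x <- B) \sum_(y <- B)
    (u x - u y) ^+ 2 * mixed_partial V z x y phi.
Proof.
move=> uB zB gB.
have gjB (j : 'I_#|` G|) : z + nth 0 G j \in B by apply/gB/mem_nth.
have rowE v j : out_grad G v z 0 j = \sum_(x <- B) v x * inc x z 0 j.
  rewrite mxE /grad/=.
  under eq_bigr do rewrite mxE /grad mulrBr.
  by rewrite sumrB !bump_sum ?gjB.
rewrite /mixed_partial -quadratic_form_laplacian.
  by rewrite /second_derivative; apply: eq_bigr => j _; rewrite rowE; congr (_ * _);
   apply: eq_bigr => i _; rewrite rowE.
move=> j; under eq_bigr do rewrite -[inc _ _ _ _]mul1r.
by rewrite -rowE mxE /grad subrr.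
Qed.

End hessian.

(** * Convexity of the Hamiltonian *)

Section convexity.
Context {R : realType} {d : nat} (G : {fset lattice d}).
Implicit Types (V : potentials (R := R) G) (x y z : lattice d) (phi psi u : lattice d -> R)
  (A : {fset lattice d}).

Hypothesis admG : admissible_steps G.

Definition neighbourhood A : seq (lattice d) :=
  undup ((A : seq _) ++ [seq x + g | x <- A, g <- G]).

Lemma neighbourhoodP A z :
  reflect (gball G z 1 `&` [set` A] !=set0) (z \in neighbourhood A).
Proof.
have [_ symG _] := admG.
apply: (iffP idP); rewrite mem_undup mem_cat.
  case/orP => [zA|/allpairsP[[x g] /= [xA gG ->]]].
    by exists z; split => //; apply/gball1P => //; left.
  by exists x; split => //; apply/gball1P => //; right; rewrite addrAC subrr add0r.
case=> x [/(gball1P admG)[->|zx] xA]; first by rewrite xA.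
apply/orP; right; apply/allpairsP; exists (x, z - x); split => //=.
by rewrite subrKC.
Qed.

Lemma hamiltonianE V A phi :
  hamiltonian V A phi = \sum_(z <- neighbourhood A) energy V z phi.
Proof.
rewrite fsbig_seq ?undup_uniq// /hamiltonian.
rewrite (_ : [set x | _] = [set` neighbourhood A])//.
by apply/seteqP; split => z /= /neighbourhoodP.
Qed.

Lemma out_grad_bump0 z x : ~ gball G z 1 x -> out_grad G (@bump R d x) z = 0.
Proof.
have [_ symG _] := admG.
move=> nb; apply/rowP => j; rewrite !mxE /grad /bump /=.
have -> : (z == x) = false.
  by apply/eqP => zx; apply: nb; apply/gball1P => //; left.
have -> : (z + nth 0 G j == x) = false.
  apply/eqP => zx; apply: nb; apply/gball1P => //; right.
  by rewrite -zx opprD addNKr; apply/symG/mem_nth.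
by rewrite subrr.
Qed.

Lemma mixed_partial_out_ball V z x y phi : ~ ([set x; y] `<=` gball G z 1) -> mixed_partial V z x y phi = 0.
Proof.
move=> nxy; rewrite /mixed_partial.
have [zx|/out_grad_bump0 ->] := pselect (gball G z 1 x); last first.
  rewrite big1// => j _; rewrite [X in _ * X]big1 ?mulr0// => i _.
  by rewrite mxE mul0r.
have [zy|/out_grad_bump0 ->] := pselect (gball G z 1 y); last first.
  by rewrite big1// => j _; rewrite mxE mul0r.
by case: nxy => w [->|->].
Qed.

(** Summed over z, the mixed derivatives at x and y give the conductance of the
pair {x, y}, which is at least 1/c0 on edges and vanishes off them.  The sum over
z in [neighbourhood A] misses some of the potentials only when neither x nor y
lies in A, and then u x = u y.  The Dirichlet energy of u is bounded below through its finite partial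
sums, indexed by F. *)
Lemma hamiltonian_convex V (c0 alpha : R) A phi u (F : seq (lattice d)) :
    0 < c0 -> admissible_potentials c0 alpha V ->
    (forall x, x \notin A -> u x = 0) -> uniq F ->
  (2 * c0)^-1 * \sum_(x <- F) \sum_(g <- G) (u (x + g) - u x) ^+ 2 <=
  hamiltonian V A (phi \+ u) + hamiltonian V A (phi \- u) - 2 * hamiltonian V A phi.
Proof.
move=> c00 [_ C2 _ _ conv] uA uF.
have [_ symG _] := admG.
have dV z eta : differentiable (V z) eta by case: (C2 z) => /(_ eta).
have ddV z j eta : differentiable (partial j (V z)) eta by case: (C2 z) => _ /(_ j eta).
rewrite !hamiltonianE; apply: second_difference_energy => // psi.
pose N := neighbourhood A.
(* B contains all vertices that occur in the potentials and in the sum over F. *)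
pose B0 := N ++ F.
pose B := undup (B0 ++ [seq x + g | x <- B0, g <- G]).
have uB : uniq B by exact: undup_uniq.
have B0B x : x \in B0 -> x \in B by move=> xB; rewrite mem_undup mem_cat; apply/orP; left.
have BG x g : x \in B0 -> g \in G -> x + g \in B.
  move=> xB gG; rewrite mem_undup mem_cat; apply/orP; right.
  by apply/allpairsP; exists (x, g).
have -> : \sum_(z <- neighbourhood A) second_derivative V z psi u =
   \sum_(x <- B) \sum_(y <- B) 2^-1 * (u x - u y) ^+ 2 *
      - (\sum_(z <- neighbourhood A) mixed_partial V z x y psi).
  rewrite (eq_big_seq (fun z => \sum_(x <- B) \sum_(y <- B)
      2^-1 * (u x - u y) ^+ 2 * - mixed_partial V z x y psi)).
    rewrite exchange_big /=; apply: eq_bigr => x _.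
    rewrite exchange_big /=; apply: eq_bigr => y _.
    by rewrite -mulr_sumr sumrN.
  move=> z zN; rewrite (@second_derivative_laplacian _ _ _ _ _ _ _ B)//.
  - rewrite mulr_sumr; apply: eq_bigr => x _.
    by rewrite mulr_sumr; apply: eq_bigr => y _; ring.
  - by apply: B0B; rewrite mem_cat zN.
  - by move=> g gG; apply: BG; rewrite // mem_cat zN.
pose q x y := 2^-1 * (u x - u y) ^+ 2 * (if edge G x y then c0^-1 else 0).
apply: (@le_trans _ _ (\sum_(x <- B) \sum_(y <- B) q x y)); last first.
  apply: ler_sum => x _; apply: ler_sum => y _.
  rewrite /q; have [->|uxy] := eqVneq (u x) (u y).
    by rewrite subrr expr0n/= mulr0 !mul0r.
  apply: ler_wpM2l; first by rewrite mulr_ge0// ?sqr_ge0// invr_ge0.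
  have [lb ub] := conv psi.
  have xy : x != y by apply: contra_neq uxy => ->.
  have mE z : pderiv (pderiv (energy V z) y) x psi = mixed_partial V z x y psi.
    by apply: pderiv2_energy.
  case: ifPn => exy; last first.
    by rewrite big1 ?oppr0// => z _; rewrite -mE; exact: ub.
  have /andP[+ _] := lb x y exy; move=> /le_trans; apply.
  rewrite (fsbigE [seq z <- N | `[< [set x; y] `<=` gball G z 1 >]])/=.
  - rewrite big_filter_cond lerN2 le_eqVlt; apply/orP; left; apply/eqP.
    rewrite [RHS]big_mkcond /=; apply: eq_bigr => z _.
    case: (asboolP ([set x; y] `<=` gball G z 1)) => /= xyz.
      by rewrite mem_set// mE.
    by rewrite mixed_partial_out_ball.
  - exact/filter_uniq/undup_uniq.
  - by move=> z /=; rewrite mem_filter => /andP[/asboolP].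
  move=> z xyz; rewrite mem_filter => /negP; case; apply/andP; split; first exact/asboolP.
  apply/neighbourhoodP.
  have [xA|/uA ux] := boolP (x \in A); first by exists x; split => //; apply: xyz; left.
  have [yA|/uA uy] := boolP (y \in A); first by exists y; split => //; apply: xyz; right.
  by rewrite ux uy eqxx in uxy.
have q0 x y : 0 <= q x y.
  apply: mulr_ge0; last by case: ifP; rewrite ?invr_ge0 ?(ltW c00).
  by apply: mulr_ge0; [rewrite invr_ge0|exact: sqr_ge0].
apply: (@le_trans _ _ (\sum_(x <- F) \sum_(y <- B) q x y)); last first.
  apply: ler_sum_uniq_subset => // [x xF|x]; last exact: sumr_ge0.
  by apply: B0B; rewrite mem_cat xF orbT.
rewrite mulr_sumr big_seq [leRHS]big_seq; apply: ler_sum => x xF.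
have xB0 : x \in B0 by rewrite mem_cat xF orbT.
rewrite mulr_sumr; apply: (@le_trans _ _ (\sum_(y <- [seq x + g | g <- G]) q x y)).
  rewrite big_map big_seq [leRHS]big_seq; apply: ler_sum => g gG.
  rewrite /q /edge addrAC subrr add0r gG invfM.
  by rewrite le_eqVlt; apply/orP; left; apply/eqP; ring.
apply: ler_sum_uniq_subset => //.
  by rewrite map_inj_uniq ?fset_uniq// => g g' /addrI.
by move=> _ /mapP[g gG ->]; exact: BG.
Qed.

Lemma hamiltonianN V (c0 alpha : R) A phi : admissible_potentials c0 alpha V ->
  hamiltonian V A (fun x => - phi x) = hamiltonian V A phi.
Proof.
move=> [_ _ sym _ _]; rewrite !hamiltonianE; apply: eq_bigr => z _.
rewrite /energy [RHS]sym; congr (V z _).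
by apply/rowP => j; rewrite !mxE /grad; ring.
Qed.

End convexity.

(** * The supremum norm on the lattice *)

Section supnorm.
Context {d : nat}.
Implicit Types (v w : lattice d).

Definition linf v : nat := \max_(i < d) `|v ord0 i|%N.

Lemma linf_leP v n : reflect (forall i, (`|v ord0 i| <= n)%N) (linf v <= n)%N.
Proof.
apply: (iffP (bigmax_leqP _ _ _)) => [h i|h i _]; last exact: h.
exact: h.
Qed.

Lemma linf_coord v i : (`|v ord0 i| <= linf v)%N.
Proof. exact: (linf_leP _ _ (leqnn _)). Qed.

Lemma linfN v : linf (- v) = linf v.
Proof. by apply: eq_bigr => i _; rewrite mxE abszN. Qed.

Lemma linf_distC v w : linf (v - w) = linf (w - v).
Proof. by rewrite -linfN opprB. Qed.

Lemma linf_triangle v w : (linf (v + w) <= linf v + linf w)%N.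
Proof.
apply/linf_leP => i; rewrite mxE.
apply: (leq_trans _ (leq_add (linf_coord v i) (linf_coord w i))).
by rewrite -lez_nat PoszD !abszE ler_normD.
Qed.

Lemma linf0 : linf (0 : lattice d) = 0%N.
Proof. by apply/eqP; rewrite -leqn0; apply/linf_leP => i; rewrite mxE. Qed.

Lemma linf_dist_triangle (u v w : lattice d) :
  (linf (u - w) <= linf (u - v) + linf (v - w))%N.
Proof. by have := linf_triangle (u - v) (v - w); rewrite subrKA. Qed.

End supnorm.

Section reach.
Context {d : nat} (G : {fset lattice d}).
Hypothesis admG : admissible_steps G.

Definition reach (n : nat) (w : lattice d) : Prop :=
  exists s : seq (lattice d), [/\ all (mem G) s, (size s <= n)%N & w = \sum_(y <- s) y].

Lemma reachW n m w : (n <= m)%N -> reach n w -> reach m w.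
Proof. by move=> nm [s [sG sn ->]]; exists s; split => //; exact: leq_trans nm. Qed.

Lemma reach0 : reach 0 0.
Proof. by exists [::]; rewrite big_nil. Qed.

Lemma reachD n m v w : reach n v -> reach m w -> reach (n + m) (v + w).
Proof.
move=> [s [sG sn ->]] [t [tG tm ->]]; exists (s ++ t).
by rewrite all_cat sG tG size_cat leq_add// big_cat.
Qed.

Lemma reachN n v : reach n v -> reach n (- v).
Proof.
have [_ symG _] := admG.
move=> [s [sG sn ->]]; exists [seq - y | y <- s]; split.
- by apply/allP => _ /mapP[y /(allP sG) yG ->]; exact: symG.
- by rewrite size_map.
- by rewrite big_map sumrN.
Qed.

Lemma reachMn n v k : reach n v -> reach (k * n) (v *+ k).
Proof.
move=> nv; elim: k => [|k IH]; first by rewrite mul0n mulr0n; exact: reach0.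
by rewrite mulSn mulrS; exact: reachD.
Qed.

Lemma reachMz n v (k : int) : reach n v -> reach (`|k|%N * n) (v *~ k).
Proof.
by case: k => k nv; [exact: reachMn|exact/reachN/reachMn].
Qed.

Lemma reach_sum (I : Type) (s : seq I) (n : I -> nat) (v : I -> lattice d) :
  (forall i, reach (n i) (v i)) -> reach (\sum_(i <- s) n i)%N (\sum_(i <- s) v i).
Proof.
move=> h; elim: s => [|i s IH]; first by rewrite !big_nil; exact: reach0.
by rewrite !big_cons; exact: reachD.
Qed.

(** A vector is the combination of the unit vectors with its entries as
coefficients, and each unit vector is a fixed finite sum of steps. *)
Lemma reach_linf : exists K : nat, forall w, reach (K * linf w) w.
Proof.
have [_ _ gen] := admG.
have /choice[f Pf] : forall i : 'I_d, exists n, reach n (delta_mx 0 i).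
  move=> i; have [s sG ->] := gen (delta_mx 0 i).
  by exists (size s), s; split => //; apply/allP.
exists (\sum_i f i)%N => w; rewrite {2}[w]row_sum_delta.
have := @reach_sum _ (index_enum 'I_d) (fun i => `|w ord0 i| * f i)%N
  (fun i => w 0 i *: delta_mx 0 i).
move=> /(_ _)/(reachW _); apply.
  rewrite mulnC big_distrr /=; apply: leq_sum => i _.
  by rewrite leq_mul2r linf_coord orbT.
by move=> i; rewrite -{2}[w ord0 i]intz scaler_int; exact: reachMz.
Qed.

End reach.

(** * A trace inequality for sparse sets of points *)

Lemma le_of_eq (R : numDomainType) (a b : R) : a = b -> a <= b.
Proof. by move->. Qed.

Section shifts.
Context {R : realType} {d : nat} (G : {fset lattice d}).
Implicit Types (u : lattice d -> R) (E : R).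

(** E bounds the Dirichlet energy of u.  Quantifying over finite sets of vertices
replaces the sum over the whole lattice. *)
Definition dirichlet_le u E : Prop := forall F : seq (lattice d), uniq F ->
  \sum_(x <- F) \sum_(g <- G) (u (x + g) - u x) ^+ 2 <= E.

Lemma dirichlet_le_ge0 u E : dirichlet_le u E -> 0 <= E.
Proof. by move=> /(_ [::] isT); rewrite big_nil. Qed.

(** Translating by n steps multiplies the norm by at most n (triangle inequality in
l^2, in the squared form (m + 1)(m a^2 + b^2) >= m (a + b)^2). *)
Lemma dirichlet_le_steps u E (s F : seq (lattice d)) :
    dirichlet_le u E -> all (mem G) s -> uniq F ->
  \sum_(x <- F) (u (x + \sum_(y <- s) y) - u x) ^+ 2 <= (size s)%:R ^+ 2 * E.
Proof.
move=> uE; have E0 := dirichlet_le_ge0 uE.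
elim: s F => [|g s IH] F /=.
  move=> _ _; rewrite big_nil expr0n/= mul0r big1// => x _.
  by rewrite addr0 subrr expr0n.
case/andP=> gG sG uF.
pose w := \sum_(y <- s) y; pose m : R := (size s)%:R.
have m0 : 0 <= m by [].
have Ea : \sum_(x <- F) (u (x + g) - u x) ^+ 2 <= E.
  apply: le_trans (uE F uF); apply: ler_sum => x _.
  rewrite (big_rem g)//= lerDl; apply: sumr_ge0 => *; exact: sqr_ge0.
have Eb : \sum_(x <- F) (u (x + g + w) - u (x + g)) ^+ 2 <= m ^+ 2 * E.
  rewrite -(big_map (fun x => x + g) xpredT (fun x => (u (x + w) - u x) ^+ 2)).
  by apply: IH => //; rewrite map_inj_uniq// => x y /addIr.
have [s0|s0] := eqVneq (size s) 0%N.
  rewrite big_cons (size0nil s0) big_nil addr0/= expr1n mul1r; exact: Ea.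
have mp : 0 < m by rewrite ltr0n lt0n.
rewrite big_cons -(@ler_pM2l _ m)// mulr_sumr.
apply: (@le_trans _ _ (\sum_(x <- F) (m + 1) * (m * (u (x + g) - u x) ^+ 2 +
    (u (x + g + w) - u (x + g)) ^+ 2))).
  apply: ler_sum => x _; rewrite addrA -/w.
  move: (u (x + g + w)) (u (x + g)) (u x) => a b c.
  have := sqr_ge0 (m * (b - c) - (a - b)).
  rewrite -subr_ge0 => h; apply: le_trans h _; rewrite le_eqVlt; apply/orP; left.
  by apply/eqP; ring.
rewrite -mulr_sumr big_split /= -mulr_sumr.
have -> : ((size s).+1)%:R = m + 1 :> R by rewrite -addn1 natrD.
nra.
Qed.

End shifts.

Section box.
Context {d : nat}.

Definition box (k : nat) : finType := {ffun 'I_d -> 'I_(8 ^ k)}.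

Definition boxvec k (b : box k) : lattice d := \row_i (b i)%:Z.

Lemma boxvec_inj k : injective (@boxvec k).
Proof.
move=> b b' /rowP bb'; apply/ffunP => i; apply: val_inj.
by have := bb' i; rewrite !mxE => -[].
Qed.

Lemma linf_boxvec k (b : box k) : (linf (boxvec b) < 8 ^ k)%N.
Proof.
rewrite -(ltn_predK (expn_gt0 8 k : (0 < 8 ^ k)%N)) ltnS; apply/linf_leP => i.
by rewrite mxE absz_nat -ltnS prednK ?expn_gt0.
Qed.

Lemma card_box k : #|box k| = (8 ^ (k * d))%N.
Proof. by rewrite card_ffun !card_ord expnM. Qed.

End box.

Section trace.
Context {R : realType} {d : nat} (G : {fset lattice d}).
Implicit Types (u : lattice d -> R) (E : R).

Notation B k := (box (d := d) k).
Definition box_volume k : R := (8 ^ (k * d))%:R.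

Lemma box_volume_gt0 k : 0 < box_volume k.
Proof. by rewrite ltr0n expn_gt0. Qed.

Definition box_average k u (x : lattice d) : R := (box_volume k)^-1 * \sum_(b : B k) u (x + boxvec b).

Lemma box_average_cst k (c : R) : (box_volume k)^-1 * \sum_(b : B k) c = c.
Proof.
by rewrite sumr_const card_box -mulr_natl mulrA mulVf ?mul1r// gt_eqF ?box_volume_gt0.
Qed.

Lemma box_average0 u x : box_average 0 u x = u x.
Proof.
rewrite /box_average (eq_bigr (fun=> u x)) ?box_average_cst// => b _.
rewrite (_ : boxvec b = 0) ?addr0//; apply/rowP => i; rewrite !mxE.
by case: (b i) => -[].
Qed.

Lemma box_averageC k l u x : box_average k (box_average l u) x = box_average l (box_average k u) x.
Proof.
rewrite /box_average -!mulr_sumr mulrCA exchange_big /=; congr (_ * (_ * _)).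
apply: eq_bigr => b _; apply: eq_bigr => c _.
by rewrite addrAC.
Qed.

Lemma box_average_sqr k (f : B k -> R) :
  ((box_volume k)^-1 * \sum_b f b) ^+ 2 <= (box_volume k)^-1 * \sum_b f b ^+ 2.
Proof.
set m := _ * \sum_b f b.
have : 0 <= (box_volume k)^-1 * \sum_b (f b - m) ^+ 2.
  rewrite mulr_ge0 ?invr_ge0 ?(ltW (box_volume_gt0 k))//.
  by apply: sumr_ge0 => b _; exact: sqr_ge0.
have -> : \sum_b (f b - m) ^+ 2 = \sum_b f b ^+ 2 - 2 * m * \sum_b f b + \sum_(b : B k) m ^+ 2.
  rewrite mulr_sumr -sumrB -big_split; apply: eq_bigr => b _ /=; ring.
rewrite mulrDr mulrBr box_average_cst mulrCA -/m -[leRHS]addr0 => h.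
rewrite -subr_ge0; apply: le_trans h _; apply: le_of_eq; ring.
Qed.

(** A point z lies in the box attached to x only if x is within 8^k of z, which by
assumption happens for at most N points x of s. *)
Lemma sum_box_le (s : seq (lattice d)) (N k : nat) (phi : lattice d -> R) (M : R) :
    (forall z, (count (fun x => linf (z - x)%R < 8 ^ k) s <= N)%N) ->
    (forall z, 0 <= phi z) ->
    (forall F, uniq F -> \sum_(z <- F) phi z <= M) ->
  \sum_(x <- s) \sum_(b : B k) phi (x + boxvec b) <= N%:R * M.
Proof.
move=> cnt phi0 phiM.
pose Z := undup [seq x + boxvec b | x <- s, b <- enum (B k)].
apply: (@le_trans _ _ (\sum_(x <- s) \sum_(z <- Z) phi z * (linf (z - x) < 8 ^ k)%N%:R)).
  rewrite big_seq [leRHS]big_seq; apply: ler_sum => x xs.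
  apply: (@le_trans _ _ (\sum_(z <- [seq x + boxvec b | b <- enum (B k)])
      phi z * (linf (z - x) < 8 ^ k)%N%:R)).
    rewrite big_map big_enum /= le_eqVlt; apply/orP; left; apply/eqP.
    by apply: eq_bigr => b _; rewrite addrAC subrr add0r linf_boxvec mulr1.
  apply: (@ler_sum_uniq_subset _ _ _ _ (fun z => phi z * (linf (z - x) < 8 ^ k)%N%:R)).
  - by rewrite map_inj_uniq ?enum_uniq// => b c /addrI /boxvec_inj.
  - exact: undup_uniq.
  - move=> _ /mapP[b bB ->]; rewrite mem_undup.
    by apply/allpairsP; exists (x, b).
  - by move=> z; rewrite mulr_ge0.
rewrite exchange_big /=.
apply: (@le_trans _ _ (\sum_(z <- Z) N%:R * phi z)).
  apply: ler_sum => z _; rewrite -mulr_sumr mulrC ler_wpM2r//.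
  rewrite -natr_sum ler_nat; apply: leq_trans (cnt z).
  by rewrite -sum1_count [leqRHS]big_mkcond /=; apply: leq_sum => x _; case: ifP.
by rewrite -mulr_sumr ler_wpM2l// phiM// undup_uniq.
Qed.

(** Jensen's inequality turns averages into sums over boxes, which overlap at most
2^k times. *)
Lemma box_average_shift u E s k n (a : lattice d) :
    dirichlet_le G u E -> reach G n a ->
    (forall z, (count (fun x => linf (z - x)%R < 8 ^ k) s <= 2 ^ k)%N) ->
  \sum_(x <- s) (box_average k u (x + a) - box_average k u x) ^+ 2 <=
    (box_volume k)^-1 * ((2 ^ k)%:R * (n%:R ^+ 2 * E)).
Proof.
move=> uE [t [tG tn ->]] cnt; set w := \sum_(y <- t) y.
have E0 := dirichlet_le_ge0 uE.
have bv0 : 0 <= (box_volume k)^-1 by rewrite invr_ge0 ltW// box_volume_gt0.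
apply: (@le_trans _ _ (\sum_(x <- s) (box_volume k)^-1 *
    \sum_(b : B k) (u (x + boxvec b + w) - u (x + boxvec b)) ^+ 2)).
  apply: ler_sum => x _; rewrite /box_average -mulrBr -sumrB.
  under eq_bigr do rewrite (addrAC x w).
  exact: box_average_sqr.
rewrite -mulr_sumr ler_wpM2l//.
apply: (@sum_box_le s (2 ^ k) k (fun z => (u (z + w) - u z) ^+ 2)) => //.
  by move=> z; exact: sqr_ge0.
move=> F uF; apply: le_trans (dirichlet_le_steps uE tG uF) _.
by rewrite ler_wpM2r// ler_sqr ?nnegrE// ler_nat.
Qed.

Variables (K : nat) (reachK : forall w : lattice d, reach G (K * linf w) w).
Hypothesis d3 : (3 <= d)%N.

(** The weighted inequality 2 y <= 1/l + l y^2 with l = eps 2^k.  The weight 2^k makes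
both resulting terms decay like 2^(- k), given that d >= 3.  The sign [sg] allows the
difference to be used in both directions. *)
Lemma box_average_gap u E s k (a : lattice d) (eps : R) (sg : R) :
    0 < eps -> sg ^+ 2 = 1 ->
    dirichlet_le G u E -> (linf a <= 8 ^ k.+1)%N ->
    (forall z, (count (fun x => linf (z - x)%R < 8 ^ k) s <= 2 ^ k)%N) ->
  2 * \sum_(x <- s) sg * (box_average k u (x + a) - box_average k u x) <=
    (2 ^ k)%:R^-1 * (eps^-1 * (size s)%:R + 64 * eps * K%:R ^+ 2 * E).
Proof.
move=> eps0 sg1 uE ak cnt.
have E0 := dirichlet_le_ge0 uE.
have Ra : reach G (K * 8 ^ k.+1) a.
  by apply: reachW (reachK a); rewrite leq_mul2l ak orbT.
have sh := box_average_shift uE Ra cnt.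
pose l : R := eps * (2 ^ k)%:R.
have k20 : 0 < (2 ^ k)%:R :> R by rewrite ltr0n expn_gt0.
have l0 : 0 < l by rewrite mulr_gt0.
apply: (@le_trans _ _ (\sum_(x <- s) (l^-1 + l * (box_average k u (x + a) - box_average k u x) ^+ 2))).
  rewrite mulr_sumr; apply: ler_sum => x _; move: (_ - _) => y.
  rewrite -(@ler_pM2l _ l)// mulrDr divff ?gt_eqF//.
  have := sqr_ge0 (1 - l * (sg * y)); rewrite -subr_ge0.
  have -> : (1 - l * (sg * y)) ^+ 2 = 1 - 2 * l * sg * y + l ^+ 2 * sg ^+ 2 * y ^+ 2 by ring.
  by rewrite sg1 => h; apply: le_trans h _; apply: le_of_eq; ring.
rewrite big_split /= -mulr_sumr mulrDr lerD//.
  rewrite big_const_seq count_predT iter_addr_0 /l invfM -mulr_natr.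
  by apply: le_of_eq; ring.
apply: (@le_trans _ _ (l * ((box_volume k)^-1 * ((2 ^ k)%:R * ((K * 8 ^ k.+1)%:R ^+ 2 * E))))).
  by rewrite ler_pM2l.
have bv : (box_volume k)^-1 * (8 ^ k)%:R ^+ 2 * (2 ^ k)%:R ^+ 3 <= 1.
  rewrite -mulrA mulrC ler_pdivrMr ?box_volume_gt0// mul1r /box_volume -!natrX -natrM ler_nat.
  have e8 m : (8 ^ m = 2 ^ (3 * m))%N by rewrite expnM.
  rewrite !e8 -!expnM -expnD leq_exp2l//.
  by have := leq_mul (leqnn k) d3; lia.
have -> : (K * 8 ^ k.+1)%:R ^+ 2 = 64 * K%:R ^+ 2 * (8 ^ k)%:R ^+ 2 :> R.
  by rewrite expnS !natrM; ring.
have -> : (2 ^ k)%:R^-1 * (64 * eps * K%:R ^+ 2 * E) =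
  (2 ^ k)%:R^-1 * (64 * eps * K%:R ^+ 2 * E) * 1 by rewrite mulr1.
apply: le_trans (ler_wpM2l _ bv); last first.
  by rewrite !mulr_ge0 ?invr_ge0 ?sqr_ge0// ltW.
rewrite /l le_eqVlt; apply/orP; left; apply/eqP; field.
by rewrite !gt_eqF ?box_volume_gt0.
Qed.

Lemma sum_box_average_le s k (f : lattice d -> B k -> R) (M : R) :
    (forall b, 2 * \sum_(x <- s) f x b <= M) ->
  2 * \sum_(x <- s) ((box_volume k)^-1 * \sum_b f x b) <= M.
Proof.
move=> fM; rewrite -mulr_sumr exchange_big /= mulrCA mulr_sumr -[leRHS](box_average_cst k).
rewrite ler_wpM2l ?invr_ge0 ?(ltW (box_volume_gt0 k))//.
by apply: ler_sum => b _; exact: fM.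
Qed.

(** Averages over boxes of sides 8^k and 8^(k+1) are compared through their
composition.  Since the two averaging operators commute, each of the two
differences is an average of the translation gaps of [box_average_gap]. *)
Lemma box_average_step u E s k (eps : R) :
    0 < eps -> dirichlet_le G u E ->
    (forall k z, (count (fun x => linf (z - x)%R < 8 ^ k) s <= 2 ^ k)%N) ->
  2 * \sum_(x <- s) (box_average k u x - box_average k.+1 u x) <=
    2 * ((2 ^ k)%:R^-1 * (eps^-1 * (size s)%:R + 64 * eps * K%:R ^+ 2 * E)).
Proof.
move=> eps0 uE cnt; set Q := (eps^-1 * _ + _).
have E0 := dirichlet_le_ge0 uE.
have Q0 : 0 <= Q by rewrite addr_ge0// !mulr_ge0// ?invr_ge0 ?sqr_ge0// ltW.
have split_avg x : box_average k u x - box_average k.+1 u x =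
    (box_volume k.+1)^-1 * (\sum_(b : B k.+1) -1 * (box_average k u (x + boxvec b) - box_average k u x)) +
    (box_volume k)^-1 * (\sum_(b : B k) 1 * (box_average k.+1 u (x + boxvec b) - box_average k.+1 u x)).
  have h1 : box_average k u x = (box_volume k.+1)^-1 * \sum_(b : B k.+1) box_average k u x by rewrite box_average_cst.
  have h2 : box_average k.+1 u x = (box_volume k)^-1 * \sum_(b : B k) box_average k.+1 u x by rewrite box_average_cst.
  under eq_bigr do rewrite mulN1r opprB.
  under [X in _ = _ + _ * X]eq_bigr do rewrite mul1r.
  rewrite !sumrB !mulrBr -h1 -h2.
  have := box_averageC k k.+1 u x; rewrite /(box_average k.+1 (box_average k u) x) /(box_average k (box_average k.+1 u) x) => ->.
  ring.
under eq_bigr do rewrite split_avg.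
rewrite big_split /= mulrDr [leRHS]mulr_natl mulr2n lerD//.
  apply: sum_box_average_le => b; apply: box_average_gap => //; first by rewrite sqrrN expr1n.
  by rewrite ltnW// linf_boxvec.
apply: sum_box_average_le => b; apply: (@le_trans _ _ ((2 ^ k.+1)%:R^-1 * Q)).
  apply: box_average_gap => //; first by rewrite expr1n.
  by rewrite ltnW// (ltn_trans (linf_boxvec b))// ltn_exp2l// ltnW.
by rewrite ler_wpM2r// lef_pV2 ?posrE ?ltr0n ?expn_gt0// ler_nat leq_exp2l.
Qed.

Lemma box_average_le u (A : {fset lattice d}) k x :
  (forall z, z \notin A -> u z = 0) ->
  box_average k u x <= (box_volume k)^-1 * \sum_(z <- A) `|u z|.
Proof.
move=> uA; rewrite /box_average ler_wpM2l ?invr_ge0 ?(ltW (box_volume_gt0 k))//.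
apply: (@le_trans _ _ (\sum_(z <- [seq x + boxvec b | b <- enum (B k)]) `|u z|)).
  by rewrite big_map big_enum /=; apply: ler_sum => b _; exact: ler_norm.
rewrite (bigID (mem A)) /= [X in _ + X]big1 ?addr0; last first.
  by move=> z /uA ->; rewrite normr0.
rewrite -big_filter; apply: (@ler_sum_uniq_subset _ _ _ _ (fun z => `|u z|)) => //.
- by apply: filter_uniq; rewrite map_inj_uniq ?enum_uniq// => b c /addrI /boxvec_inj.
- exact: fset_uniq.
- by move=> z; rewrite mem_filter => /andP[].
Qed.

(** The steps of [box_average_step] sum to a geometric series.  The averages over
large boxes tend to 0, because u has finite support. *)
Lemma trace_inequality u (A : {fset lattice d}) E s (eps : R) :
    0 < eps -> (forall z, z \notin A -> u z = 0) -> dirichlet_le G u E ->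
    (forall k z, (count (fun x => linf (z - x)%R < 8 ^ k) s <= 2 ^ k)%N) ->
  2 * \sum_(x <- s) u x <=
    4 * (eps^-1 * (size s)%:R + 64 * eps * K%:R ^+ 2 * E).
Proof.
move=> eps0 uA uE cnt; set Q := (eps^-1 * _ + _).
have E0 := dirichlet_le_ge0 uE.
have Q0 : 0 <= Q by rewrite addr_ge0// !mulr_ge0// ?invr_ge0 ?sqr_ge0// ltW.
have tel k : 2 * \sum_(x <- s) u x <=
    4 * Q * (1 - (2 ^ k)%:R^-1) + 2 * \sum_(x <- s) box_average k u x.
  elim: k => [|k IH].
    rewrite expn0 invr1 subrr mulr0 add0r.
    by under [X in _ <= _ * X]eq_bigr do rewrite box_average0.
  apply: (le_trans IH).
  have := box_average_step k eps0 uE cnt; rewrite -/Q sumrB.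
  have -> : (2 ^ k)%:R^-1 = 2 * (2 ^ k.+1)%:R^-1 :> R.
    by rewrite expnS natrM invfM mulrA divff ?mul1r.
  move: ((2 ^ k.+1)%:R^-1 : R) => y; nra.
pose S := \sum_(z <- A) `|u z|.
have S0 : 0 <= S by exact: sumr_ge0.
pose M := 2 * (size s)%:R * S.
have M0 : 0 <= M by rewrite !mulr_ge0.
have {}tel k : 2 * \sum_(x <- s) u x <= 4 * Q + (k%:R + 1)^-1 * M.
  apply: (le_trans (tel k)); apply: lerD.
    by rewrite ler_piMr ?mulr_ge0// gerBl invr_ge0.
  apply: (@le_trans _ _ (2 * \sum_(x <- s) ((box_volume k)^-1 * S))).
    by rewrite ler_pM2l//; apply: ler_sum => x _; exact: box_average_le.
  rewrite big_const_seq count_predT iter_addr_0 /M -[_ *+ size s]mulr_natl.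
  have -> : 2 * ((size s)%:R * ((box_volume k)^-1 * S)) = (box_volume k)^-1 * (2 * (size s)%:R * S) by ring.
  rewrite ler_wpM2r// lef_pV2 ?posrE ?box_volume_gt0 ?ltr_wpDl// natr1 ler_nat.
  apply: (@leq_trans (8 ^ k)); first exact: ltn_expl.
  by rewrite leq_exp2l// leq_pmulr// (leq_trans _ d3).
apply/ler_addgt0Pr => e e0.
apply: (le_trans (tel (Num.truncn (M / e)))); rewrite lerD2l.
rewrite mulrC ler_pdivrMr ?ltr_wpDl//.
have := truncnS_gt (M / e); rewrite -natr1 ltr_pdivrMr// mulrC => /ltW //.
Qed.

End trace.

(** * Trees of points along a path *)

Lemma leq_exp_base (m n e : nat) : (m <= n -> m ^ e <= n ^ e)%N.
Proof. by case: e => // e mn; rewrite leq_exp2r. Qed.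

Section tree.
Context {d : nat} (r : nat).
Implicit Types (x y z w : lattice d) (s : seq (lattice d)).

(** Points x and y that are the roots of two sibling subtrees of height n are at
distance between [shell_radius n] and [shell_radius n + r], where r bounds the
length of a step.  The factor r + 3 makes the separation of the subtrees beat twice their radius
plus 2 * 8^n, see [trees_sparse]. *)
Definition shell_radius (n : nat) : nat := ((r + 3) * 8 ^ n)%N.

(** This number has two roles: the leaves of a tree of height n are within this
distance of its root ([trees_near]), and a path reaching this far from its starting
point contains the leaves of such a tree ([trees_cover]). *)
Fixpoint tree_radius (n : nat) : nat :=
  if n is m.+1 then (shell_radius m + r + tree_radius m)%N else 0%N.

Lemma tree_radius_le n : (7 * tree_radius n <= (2 * r + 3) * 8 ^ n)%N.
Proof.
elim: n => [|n IH] /=; first by rewrite muln0.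
have : (0 < 8 ^ n)%N by rewrite expn_gt0.
rewrite /shell_radius expnS; move: (8 ^ n)%N IH => t; nia.
Qed.

Definition shell_box (m : nat) : finType := {ffun 'I_d -> 'I_(2 * m).+1}.

Definition shell (n : nat) (x : lattice d) : seq (lattice d) :=
  [seq y <- [seq x + \row_i ((b i : nat)%:Z - (shell_radius n + r)%N%:Z) | b : shell_box (shell_radius n + r) <- enum (shell_box (shell_radius n + r))]
   | (shell_radius n <= linf (y - x)%R)%N].

Lemma mem_shell n x y : (shell_radius n <= linf (y - x)%R <= shell_radius n + r)%N -> y \in shell n x.
Proof.
case/andP=> lo hi; rewrite mem_filter lo /=.
apply/mapP; exists [ffun i => inord `|((y - x) ord0 i + (shell_radius n + r)%N%:Z)%R|%N].
  by rewrite mem_enum.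
apply/rowP => i; rewrite mxE [in RHS]mxE ffunE.
have := leq_trans (linf_coord (y - x) i) hi; rewrite !mxE.
move: (shell_radius n + r)%N => m.
rewrite -[y 0 i]/(y ord0 i) -[x 0 i]/(x ord0 i).
move: (y ord0 i : int) (x ord0 i : int) => a b h.
rewrite inordK; by lia.
Qed.

Lemma shell_dist n x y : y \in shell n x -> (shell_radius n <= linf (y - x)%R)%N.
Proof. by rewrite mem_filter => /andP[]. Qed.

Lemma shell_dist_le n x y : y \in shell n x -> (linf (y - x)%R <= shell_radius n + r)%N.
Proof.
rewrite mem_filter => /andP[_ /mapP[b _ ->]].
rewrite addrAC subrr add0r; apply/linf_leP => i; rewrite mxE.
by have := ltn_ord (b i); move: (shell_radius n + r)%N (nat_of_ord _) => m c; lia.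
Qed.

Lemma size_shell n x : (size (shell n x) <= (2 * (shell_radius n + r)).+1 ^ d)%N.
Proof.
rewrite size_filter (leq_trans (count_size _ _))// size_map -cardE.
by rewrite card_ffun !card_ord.
Qed.

(** A tree is recorded by the list of its leaves.  The first subtree keeps the root x,
the second one is rooted in a shell around x. *)
Fixpoint trees (n : nat) (x : lattice d) : seq (seq (lattice d)) :=
  if n is m.+1 then
    [seq p.1 ++ p.2 | p <- [seq (s, s') | s <- trees m x,
       s' <- flatten [seq trees m y | y <- shell m x]]]
  else [:: [:: x]].

Lemma treesSP n x s : reflect
  (exists s1 s2 y, [/\ s1 \in trees n x, y \in shell n x, s2 \in trees n y & s = s1 ++ s2])
  (s \in trees n.+1 x).
Proof.
apply: (iffP mapP) => [[[s1 s2] /allpairsP[[a b] /= [a1 /flatten_mapP[y yx b1] [-> ->]]] ->]|].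
  by exists a, b, y.
move=> [s1 [s2 [y [h1 h2 h3 ->]]]]; exists (s1, s2) => //.
apply/allpairsP; exists (s1, s2); split => //=.
by apply/flatten_mapP; exists y.
Qed.

Lemma size_trees (n : nat) x s : s \in trees n x -> size s = (2 ^ n)%N.
Proof.
elim: n x s => [|n IH] x s; first by rewrite inE => /eqP ->.
case/treesSP => s1 [s2 [y [h1 _ h3 ->]]].
by rewrite size_cat (IH _ _ h1) (IH _ _ h3) expnS mul2n addnn.
Qed.

Lemma trees_near n x s w : s \in trees n x -> w \in s -> (linf (w - x)%R <= tree_radius n)%N.
Proof.
elim: n x s => [|n IH] x s.
  by rewrite inE => /eqP ->; rewrite inE => /eqP ->; rewrite subrr linf0.
case/treesSP => s1 [s2 [y [h1 /shell_dist_le yx h3 ->]]]; rewrite mem_cat => /orP[ws|ws] /=.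
  by apply: leq_trans (IH _ _ h1 ws) _; rewrite leq_addl.
apply: leq_trans (linf_dist_triangle w y x) _.
by rewrite addnC leq_add// (IH _ _ h3).
Qed.

(** Up to height k, a tree has at most 2^k leaves.  Above, a ball of radius 8^k
cannot meet both subtrees. *)
Lemma trees_sparse n x s k z : s \in trees n x ->
  (count (fun w => linf (z - w)%R < 8 ^ k) s <= 2 ^ k)%N.
Proof.
elim: n x s => [|n IH] x s.
  rewrite inE => /eqP -> /=; rewrite addn0.
  by apply: (leq_trans (leq_b1 _)); rewrite expn_gt0.
move=> sT; have [nk|kn] := ltnP n k.
  by rewrite (leq_trans (count_size _ _))// (size_trees sT) leq_exp2l.
case/treesSP: sT => s1 [s2 [y [h1 /shell_dist yx h3 ->]]]; rewrite count_cat.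
have [/hasP[w w1 /= wz]|/negbTE] := boolP (has (fun w => linf (z - w)%R < 8 ^ k)%N s1); last first.
  rewrite has_count lt0n => /negbFE/eqP ->; exact: IH h3.
have [/hasP[w' w2 /= wz']|/negbTE] := boolP (has (fun w => linf (z - w)%R < 8 ^ k)%N s2); last first.
  rewrite has_count lt0n => /negbFE/eqP ->; rewrite addn0; exact: IH h1.
exfalso.
have a1 := trees_near h1 w1; have a2 := trees_near h3 w2.
have := linf_dist_triangle y w' x; have := linf_dist_triangle w' z x.
have := linf_dist_triangle z w x.
rewrite (linf_distC y w') (linf_distC w' z).
have := tree_radius_le n; have : (8 ^ k <= 8 ^ n)%N by rewrite leq_exp2l.
have -> : ((2 * r + 3) * 8 ^ n = 2 * (r * 8 ^ n) + 3 * 8 ^ n)%N by lia.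
move: yx a1 a2 wz wz'; rewrite /shell_radius mulnDl.
move: (linf (y - x)) (linf (w - x)) (linf (w' - y)) (linf (z - w)) (linf (z - w'))
  (linf (z - x)) (linf (w' - x)) (8 ^ k)%N (8 ^ n)%N (tree_radius n) => a b c e f g h i j l.
by move: (r * j)%N => q; lia.
Qed.

(** The path reaches far enough from x to contain the first subtree.  Its first
vertex y with [shell_radius n <= linf (y - x)] lies in the shell, and the rest of
the path still reaches far enough from y to contain a second subtree. *)
Lemma trees_cover (G : {fset lattice d}) n x p w :
    (forall g, g \in G -> (linf g <= r)%N) ->
    path (edge G) x p -> w \in x :: p -> (tree_radius n <= linf (w - x)%R)%N ->
  exists2 s, s \in trees n x & {subset s <= x :: p}.
Proof.
move=> Gr; elim: n x p w => [|n IH] x p w pp wp /= xw.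
  by exists [:: x]; rewrite ?inE// => z; rewrite !inE => /eqP ->; rewrite eqxx.
have [s1 s1T s1p] : exists2 s, s \in trees n x & {subset s <= x :: p}.
  by apply: (IH x p w) => //; apply: leq_trans xw; rewrite leq_addl.
have radw : (shell_radius n <= linf (w - x)%R)%N.
  by apply: leq_trans xw; rewrite -addnA leq_addr.
have rad0 : (0 < shell_radius n)%N by rewrite muln_gt0 expn_gt0 addn_gt0 orbT.
pose far y := (shell_radius n <= linf (y - x)%R)%N.
have xfar : ~~ far x by rewrite /far subrr linf0 -ltnNge.
have wp' : w \in p.
  by move: wp; rewrite inE => /orP[/eqP wx|//]; move: radw; rewrite wx => /(negP xfar).
have hasfar : has far p by apply/hasP; exists w.
(* The path is cut at its first far vertex. *)
have [p1 [y [p2 [pE yfar p1near]]]] : exists p1 y p2,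
    [/\ p = p1 ++ y :: p2, far y & all (predC far) p1].
  case: (split_find hasfar) pp => y p1 p2 yfar p1near _.
  exists p1, y, p2; split; rewrite ?cat_rcons//.
  by rewrite all_predC.
have /andP[pp1 /= /andP[ey pp2]] : path (edge G) x p1 && path (edge G) (last x p1) (y :: p2).
  by rewrite -cat_path -pE.
have lastnear : ~~ far (last x p1).
  have := mem_last x p1; rewrite inE => /orP[/eqP ->//|/(allP p1near)//].
have yx : (linf (y - x)%R <= shell_radius n + r)%N.
  apply: leq_trans (linf_dist_triangle y (last x p1) x) _.
  rewrite addnC leq_add//; last exact: Gr.
  by move: lastnear; rewrite /far -ltnNge => /ltnW.
have wy : w \in y :: p2.
  move: wp'; rewrite pE mem_cat => /orP[/(allP p1near)/=|//].
  by rewrite /far radw.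
have [s2 s2T s2p] : exists2 s, s \in trees n y & {subset s <= y :: p2}.
  apply: (IH y p2 w) => //.
  rewrite -(leq_add2r (linf (y - x))).
  apply: leq_trans (leq_trans xw (linf_dist_triangle w y x)).
  by rewrite /= addnC leq_add2r.
exists (s1 ++ s2).
  by apply/treesSP; exists s1, s2, y; split => //; apply: mem_shell; apply/andP.
move=> z; rewrite mem_cat => /orP[/s1p//|/s2p zy].
by rewrite pE -cat_cons mem_cat zy orbT.
Qed.

Definition tree_base : nat := ((8 * (4 * r + 7)) ^ d)%N.

(** The number of trees satisfies N_(n+1) <= N_n^2 (c 8^n)^d.  The factor
(c 8^(n+1))^d in the induction hypothesis turns this recursion into squaring. *)
Lemma size_trees_le n x : (size (trees n x) <= tree_base ^ (2 ^ n))%N.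
Proof.
pose c := (4 * r + 7)%N.
have main : (size (trees n x) * (c * 8 ^ n.+1) ^ d <= tree_base ^ (2 ^ n))%N.
  elim: n x => [|n IH] x.
    by rewrite mul1n expn0 !expn1 mulnC.
  have IHy m (IHm : forall y, (size (trees n y) * m <= tree_base ^ (2 ^ n))%N) :
    (size (trees n.+1 x) * m ^ 2 <= (tree_base ^ (2 ^ n)) ^ 2 * size (shell n x))%N.
    rewrite /= size_map size_allpairs size_flatten /shape -map_comp.
    have : (sumn [seq size (trees n y) | y <- shell n x] * m <=
        size (shell n x) * tree_base ^ 2 ^ n)%N.
      elim: (shell n x) => [|y l IHl] /=; first by rewrite mul0n.
      by rewrite mulnDl mulSn leq_add.
    rewrite (eq_map (g := fun y => size (trees n y)))//.
    move: (sumn _) (IHm x) (size (shell n x)) => a b e.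
    move: (size _) b => f; rewrite -!mulnn; move: (tree_base ^ _)%N => g h1 h2.
    by have := leq_mul h1 h2; lia.
  have step := IHy _ IH.
  have sh : (size (shell n x) <= (c * 8 ^ n) ^ d)%N.
    apply: leq_trans (size_shell n x) _; apply: leq_exp_base.
    have : (0 < 8 ^ n)%N by rewrite expn_gt0.
    rewrite /shell_radius /c; move: (8 ^ n)%N => t; nia.
  have sh0 : (0 < (c * 8 ^ n) ^ d)%N.
    by rewrite expn_gt0 muln_gt0 expn_gt0 /c addn_gt0 orbT.
  have m2 : (((c * 8 ^ n.+1) ^ d) ^ 2 = (c * 8 ^ n.+2) ^ d * (c * 8 ^ n) ^ d)%N.
    by rewrite -[RHS]expnMn -!mulnn -expnMn; congr (expn _ d); rewrite !expnS; lia.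
  rewrite -(leq_pmul2r sh0) -mulnA -m2 (leq_trans step)//.
  by rewrite -expnM -expnSr leq_mul2l sh orbT.
apply: leq_trans main; apply: leq_pmulr.
by rewrite expn_gt0 muln_gt0 expn_gt0 /c addn_gt0 orbT.
Qed.

End tree.

(** * Measurability of functions of the field *)

(** Rounding the arguments down to multiples of 1/(k+1) makes the composite
a function of countably many values; it converges pointwise by continuity. *)
Lemma measurable_fun_row (R : realType) disp (T : measurableType disp) (n : nat)
    (F : 'rV[R]_n -> R) (f : 'I_n -> T -> R) :
  continuous F -> (forall j, measurable_fun setT (f j)) ->
  measurable_fun setT (fun x => F (\row_j f j x)).
Proof.
move=> cF mf.
pose m (k : nat) (x : T) : 'rV[int]_n := \row_j Num.floor (k.+1%:R * f j x).
pose dec (k : nat) (c : 'rV[int]_n) : 'rV[R]_n := \row_j ((c 0 j)%:~R / k.+1%:R).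
apply: (@measurable_fun_cvg _ _ _ setT (fun k x => F (dec k (m k x)))) => [k|x _].
  move=> _ B mB; rewrite setTI.
  rewrite (_ : _ @^-1` B = \bigcup_(c : 'rV[int]_n) (if F (dec k c) \in B then
      \bigcap_(j in [set: 'I_n]) [set x | (c 0 j)%:~R <= k.+1%:R * f j x < (c 0 j)%:~R + 1]
      else set0)).
    apply: countable_bigcupT_measurable => [|c]; first exact: countableP.
    case: ifP => _ //; apply: fin_bigcap_measurable => // j _.
    rewrite (_ : [set x | _] = (fun x => k.+1%:R * f j x) @^-1` `[(c 0 j)%:~R, (c 0 j)%:~R + 1[).
      rewrite -[X in measurable X]setTI.
      by apply: measurable_funM => //; exact: measurable_itv.
    by apply/seteqP; split => x /=; rewrite in_itv.
  apply/seteqP; split => [x /= xB|x [c _]].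
    exists (m k x) => //; rewrite mem_set// => j _ /=.
    by rewrite mxE ge_floor -intrD1 floorD1_gt.
  case: ifPn => // /set_mem Bc cx; rewrite /preimage /=.
  rewrite (_ : m k x = c)//; apply/rowP => j; rewrite mxE.
  by apply/floor_def; have := cx j I; rewrite /= intrD1.
apply: (@cvg_comp _ _ _ (fun k => dec k (m k x)) F \oo (nbhs (\row_j f j x)) (nbhs (F (\row_j f j x)))); last exact: cF.
apply/cvg_ballP => e e0; near=> k; split => // i j /=.
rewrite !mxE /ball /=.
have k0 : 0 < k.+1%:R :> R by [].
rewrite -(@ltr_pM2l _ k.+1%:R)// -[X in X * `|_|]gtr0_norm// -normrM mulrBr.
rewrite mulrCA divff ?gt_eqF// mulr1 ger0_norm ?subr_ge0 ?ge_floor//.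
rewrite (@lt_le_trans _ _ 1)//.
  by rewrite ltrBlDr addrC -intrD1 floorD1_gt.
rewrite -ler_pdivrMr// div1r; apply: (@le_trans _ _ k%:R); last by rewrite ler_nat.
near: k; exact: nbhs_infty_ger.
Unshelve. all: by end_near. Qed.

(** * Gaussian tails in finite volume *)

Section spins.
Context {R : realType} {d : nat}.
Notation Om := (Omega R d).
Implicit Types (s : seq (lattice d)).

Lemma measurable_coord (x : lattice d) : measurable_fun setT (fun phi : Om => phi x).
Proof.
move=> _ B mB; apply: sub_sigma_algebra; exists x => //.
by exists B.
Qed.

Lemma measurable_fun_spins s : measurable_fun setT (fun phi : Om => \sum_(x <- s) phi x).
Proof. by apply: measurable_sum => x; exact: measurable_coord. Qed.

Lemma measurable_sum_ge s (a : R) : measurable [set phi : Om | a <= \sum_(x <- s) phi x].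
Proof.
rewrite (_ : [set phi | _] = (fun phi : Om => \sum_(x <- s) phi x) @^-1` `[a, +oo[).
  by rewrite -[X in measurable X]setTI; apply: measurable_fun_spins => //; exact: measurable_itv.
by apply/seteqP; split => phi /=; rewrite in_itv/= andbT.
Qed.

Lemma measurable_all_above (h : R) s :
  measurable [set phi : Om | forall w, w \in s -> h <= phi w].
Proof.
elim: s => [|x s IH].
  by rewrite (_ : [set phi | _] = setT)//; apply/seteqP; split.
rewrite (_ : [set phi | _] = [set phi : Om | h <= \sum_(y <- [:: x]) phi y] `&`
    [set phi : Om | forall w, w \in s -> h <= phi w]).
  by apply: measurableI => //; exact: measurable_sum_ge.
apply/seteqP; split => phi /=; rewrite big_seq1.
  by move=> H; split => [|w ws]; apply: H; rewrite inE ?eqxx ?ws ?orbT.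
by move=> [hx H] w; rewrite inE => /orP[/eqP ->//|/H].
Qed.

End spins.

Section finite_volume.
Context {R : realType} {d : nat} (G : {fset lattice d}).
Implicit Types (A : {fset lattice d}) (V : potentials (R := R) G).
Notation T := (measurableTypeR R).
Notation lebn := (@lebesgue_tuple R).

Lemma extend0_out A (v : #|` A|.-tuple T) x : x \notin A -> extend0 v x = 0.
Proof. by rewrite /extend0 => /negbTE ->. Qed.

Lemma extend0_in A x : x \in A ->
  exists i, forall v : #|` A|.-tuple T, extend0 v x = tnth v i.
Proof.
move=> xA; have i : (index x A < #|` A|)%N by rewrite index_mem.
by exists (Ordinal i) => v; rewrite /extend0 xA (tnth_nth 0).
Qed.

Lemma measurable_extend0 A (x : lattice d) :
  measurable_fun setT (fun v : #|` A|.-tuple T => extend0 v x : R).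
Proof.
have [/extend0_in[i vi]|xA] := boolP (x \in A).
  by rewrite (_ : (fun v => _) = (fun v => tnth v i)); [exact: measurable_tnth|exact/funext].
rewrite (_ : (fun v => _) = cst 0); first exact: measurable_cst.
by apply/funext => v; rewrite extend0_out.
Qed.

Lemma extend0_topp A (v : #|` A|.-tuple T) x : extend0 (topp v) x = - extend0 v x.
Proof.
have [/extend0_in[i vi]|xA] := boolP (x \in A); last by rewrite !extend0_out// oppr0.
by rewrite !vi tnth_mktuple.
Qed.

Lemma extend0_tmidpoint A (v w : #|` A|.-tuple T) x :
  extend0 (tmidpoint v w) x = (extend0 v x + extend0 w x) / 2.
Proof.
have [/extend0_in[i vi]|xA] := boolP (x \in A).
  by rewrite !vi tnth_mktuple.
by rewrite !extend0_out// addr0 mul0r.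
Qed.

Variables (V : potentials (R := R) G) (c0 alpha : R) (A : {fset lattice d}).
Hypotheses (admG : admissible_steps G) (c00 : 0 < c0)
  (admV : admissible_potentials c0 alpha V).

Let ham (v : #|` A|.-tuple T) : R := hamiltonian V A (extend0 v).

Lemma measurable_ham : measurable_fun setT ham.
Proof.
rewrite /ham (_ : (fun v => _) = (fun v : #|` A|.-tuple T =>
    \sum_(z <- neighbourhood G A) energy V z (extend0 v))); last first.
  by apply/funext => v; rewrite hamiltonianE.
apply: measurable_sum => z; apply: measurable_fun_row.
  case: admV => _ C2 _ _ _; case: (C2 z) => dV _ _ _ eta.
  exact: differentiable_continuous.
by move=> j; apply: measurable_funB; exact: measurable_extend0.
Qed.

Variables (K : nat) (reachK : forall w : lattice d, reach G (K * linf w) w).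
Hypothesis d3 : (3 <= d)%N.

(** With eps = 1/(512 (K^2 + 1) c0), the energy term of [trace_inequality] is absorbed
by convexity, and the other term is 4 / eps = [tail_rate] per point. *)
Definition tail_rate : R := 2048 * (K%:R ^+ 2 + 1) * c0.

Variable s : seq (lattice d).
Hypothesis sparse : forall k z, (count (fun x => linf (z - x)%R < 8 ^ k) s <= 2 ^ k)%N.

Let S (v : #|` A|.-tuple T) : R := \sum_(x <- s) extend0 v x.

Lemma measurable_S : measurable_fun setT S.
Proof. by apply: measurable_sum => x; exact: measurable_extend0. Qed.

(** The hypothesis of [prekopa_leindler] for exp(S - H), exp(- S - H) and
exp([tail_rate] * size s / 2 - H): apply [trace_inequality] to half the difference
of the two configurations, whose Dirichlet energy is controlled by
[hamiltonian_convex]. *)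
Lemma hamiltonian_midpoint v w :
  S v - S w - (ham v + ham w) <= tail_rate * (size s)%:R - 2 * ham (tmidpoint v w).
Proof.
pose phi : lattice d -> R := extend0 (tmidpoint v w).
pose u : lattice d -> R := fun x => (extend0 v x - extend0 w x) / 2.
have vE : extend0 v = phi \+ u.
  by apply/funext => x; rewrite /phi /u/= extend0_tmidpoint; field.
have wE : extend0 w = phi \- u.
  by apply/funext => x; rewrite /phi /u/= extend0_tmidpoint; field.
have uA x : x \notin A -> u x = 0.
  by move=> xA; rewrite /u !extend0_out// subrr mul0r.
pose E := 2 * c0 * (ham v + ham w - 2 * ham (tmidpoint v w)).
have uE : dirichlet_le G u E.
  move=> F uF; have := hamiltonian_convex admG phi c00 admV uA uF.
  by rewrite mulrC ler_pdivrMr ?mulr_gt0// -vE -wE mulrC.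
have E0 := dirichlet_le_ge0 uE.
pose K2 : R := K%:R ^+ 2 + 1.
have K20 : 0 < K2 by rewrite ltr_wpDl// sqr_ge0.
pose eps := (512 * K2 * c0)^-1.
have eps0 : 0 < eps.
  by rewrite invr_gt0; apply: mulr_gt0 c00; apply: mulr_gt0 K20; rewrite ltr0n.
have := trace_inequality reachK d3 eps0 uA uE sparse.
have -> : 2 * \sum_(x <- s) u x = S v - S w.
  by rewrite /S -sumrB mulr_sumr; apply: eq_bigr => x _; rewrite /u; field.
move=> tr.
have e2 : 4 * (64 * eps * K%:R ^+ 2 * E) <= ham v + ham w - 2 * ham (tmidpoint v w).
  have -> : 4 * (64 * eps * K%:R ^+ 2 * E) =
      (K%:R ^+ 2 / K2) * (ham v + ham w - 2 * ham (tmidpoint v w)).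
    by rewrite /E /eps; field; rewrite !gt_eqF.
  rewrite ler_piMl//; last by rewrite ler_pdivrMr// mul1r /K2 lerDl.
  by move: E0; rewrite /E pmulr_rge0 ?mulr_gt0.
have e1 : 4 * (eps^-1 * (size s)%:R) = tail_rate * (size s)%:R.
  by rewrite /eps invrK /tail_rate -/K2; ring.
by move: tr; rewrite mulrDr e1; move: e2; lra.
Qed.

(** A Brascamp-Lieb inequality for exponential moments.  As H is even, reflecting the
configuration exchanges exp(S - H) and exp(- S - H). *)
Lemma exponential_moment :
  (\int[lebn #|` A|]_v (expR (S v - ham v))%:E <=
   (expR (tail_rate * (size s)%:R / 2))%:E *
     \int[lebn #|` A|]_v (expR (- ham v))%:E)%E.
Proof.
set c := tail_rate * _.
have mexp (f : #|` A|.-tuple T -> R) : measurable_fun setT f ->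
    measurable_fun setT (fun v => (expR (f v))%:E).
  by move=> mf; apply/measurable_EFinP; apply: measurableT_comp.
have mS := measurable_S; have mH := measurable_ham.
have mHN : measurable_fun setT (fun v => - ham v) by apply: measurable_funN.
pose f v := (expR (S v - ham v))%:E.
pose g v := (expR (- S v - ham v))%:E.
pose h v := (expR (c / 2 - ham v))%:E.
have mf : measurable_fun setT f by apply: mexp; apply: measurable_funB.
have mg : measurable_fun setT g.
  by apply: mexp; apply: measurable_funB => //; apply: measurable_funN.
have mh : measurable_fun setT h by apply: mexp; apply: measurable_funB.
have pos (k : #|` A|.-tuple T -> R) v : (0 <= (expR (k v))%:E)%E by rewrite lee_fin expR_ge0.
have hE : (\int[lebn #|` A|]_v h v =
    (expR (c / 2))%:E * \int[lebn #|` A|]_v (expR (- ham v))%:E)%E.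
  rewrite -ge0_integralZl//; last exact: mexp.
  by apply: eq_integral => v _; rewrite /h expRD EFinM.
rewrite -hE.
have gf : (\int[lebn #|` A|]_v g v = \int[lebn #|` A|]_v f v)%E.
  rewrite -[RHS](integral_lebesgue_tupleN mf (pos _)).
  apply: eq_integral => v _; rewrite /f /g; congr (expR _)%:E; congr (_ - _).
    by rewrite /S -sumrN; apply: eq_bigr => x _; rewrite extend0_topp.
  rewrite /ham -(hamiltonianN admG A (extend0 v) admV); congr hamiltonian.
  by apply/funext => x; rewrite extend0_topp.
have := @prekopa_leindler R _ f g h mf mg mh (pos _) (pos _) (pos _).
rewrite gf => PL.
have : (\int[lebn #|` A|]_v f v * \int[lebn #|` A|]_v f v <=
    \int[lebn #|` A|]_v h v * \int[lebn #|` A|]_v h v)%E.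
  apply: PL => v w; rewrite -!EFinM lee_fin -!expRD ler_expR.
  have := hamiltonian_midpoint v w; rewrite -/c; lra.
have : (0 <= \int[lebn #|` A|]_v f v)%E by apply: integral_ge0 => v _; rewrite lee_fin expR_ge0.
have : (0 <= \int[lebn #|` A|]_v h v)%E by apply: integral_ge0 => v _; rewrite lee_fin expR_ge0.
move: (integral _ _ f) (integral _ _ h) => F H H0 F0 FH.
rewrite leNgt; apply/negP => HF; move: FH; apply/negP; rewrite -ltNge.
move: F H F0 H0 HF => [F||] [H||]//; rewrite ?lee_fin ?lte_fin => F0 H0 HF.
  by rewrite -!expr2 ltr_sqr.
by rewrite mulyy -EFinM ltry.
Qed.

(** The exponential Markov inequality; the normalizing constant is removed by
[P setT = 1]. *)
Lemma gibbs_tail (P : probability (Omega R d) R) (a : R) : is_gibbs V A P ->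
  (P [set phi | (a <= \sum_(x <- s) phi x)%R] <=
   (expR (tail_rate * (size s)%:R / 2 - a))%:E)%E.
Proof.
move=> [C C0 PE].
have mE := @measurable_sum_ge R d s a.
rewrite PE//; set D := _ @^-1` _.
have : (1 = C%:E * \int[lebn #|` A|]_v (expR (- ham v))%:E)%E.
  by rewrite -(@probability_setT _ _ _ P) PE// preimage_setT.
set Z := integral _ _ _ => PZ.
have mS := measurable_S; have mH := measurable_ham.
have mexp (f : #|` A|.-tuple T -> R) B : measurable_fun setT f ->
    measurable_fun B (fun v => (expR (f v))%:E).
  by move=> mf; apply: measurable_funTS; apply/measurable_EFinP; apply: measurableT_comp.
have mD : measurable D.
  rewrite (_ : D = S @^-1` `[a, +oo[).
    by rewrite -[X in measurable X]setTI; apply: mS => //; exact: measurable_itv.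
  by apply/seteqP; split => v /=; rewrite in_itv/= andbT.
apply: (@le_trans _ _ (C%:E * ((expR (- a))%:E *
    \int[lebn #|` A|]_v (expR (S v - ham v))%:E))%E).
  rewrite lee_pmul2l// -ge0_integralZl//; last first.
  - by apply: mexp; apply: measurable_funB.
  apply: (@le_trans _ _ (\int[lebn #|` A|]_(v in D) ((expR (- a))%:E * (expR (S v - ham v))%:E))%E).
    apply: ge0_le_integral => //.
    - by apply: mexp; apply: measurable_funN.
    - apply: measurable_funeM; (by apply: mexp; apply: measurable_funB).
    - move=> v Dv; rewrite -EFinM lee_fin -expRD ler_expR -/(ham v).
      have av : a <= S v := Dv; lra.
  apply: ge0_subset_integral => //.
  apply: measurable_funeM; (by apply: mexp; apply: measurable_funB).
apply: (@le_trans _ _ (C%:E * ((expR (- a))%:E * ((expR (tail_rate * (size s)%:R / 2))%:E * Z)))%E).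
  by rewrite lee_pmul2l// lee_pmul2l// ?lte_fin ?expR_gt0// exponential_moment.
rewrite muleCA [X in (_ * X)%E]muleCA -PZ mule1 -EFinM lee_fin -expRD ler_expR; lra.
Qed.

End finite_volume.

(** * Tails of the limit and decay of the connection probability *)

Lemma real_continuousD (R : realType) (X : topologicalType) (f g : X -> R) :
  continuous f -> continuous g -> continuous (fun x => f x + g x).
Proof. by move=> cf cg x; apply: cvgD; [exact: cf|exact: cg]. Qed.

Lemma clamp_continuous (R : realType) (X : topologicalType) (f : X -> R) (a : R) :
  continuous f -> continuous (fun x => Num.min 1 (Num.max 0 (f x - a))).
Proof.
move=> cf x; apply: (@continuous_min R X (fun=> 1) (fun x => Num.max 0 (f x - a))).
  exact: cvg_cst.
apply: (@continuous_max R X (fun=> 0) (fun x => f x - a)); first exact: cvg_cst.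
by apply: cvgB; [exact: cf|exact: cvg_cst].
Qed.

Section infinite_volume.
Context {R : realType} {d : nat} (G : {fset lattice d}).
Notation Om := (Omega R d).
Implicit Types (s : seq (lattice d)) (mu : probability (Omega R d) R).

Lemma spins_continuous s :
  continuous ((fun phi => \sum_(x <- s) phi x) : {ptws lattice d -> R} -> R).
Proof.
elim: s => [|x s IH].
  have -> : (fun phi : {ptws lattice d -> R} => \sum_(x <- [::]) phi x) = cst 0.
    by apply/funext => phi; rewrite big_nil.
  by move=> phi; apply: (cst_continuous (T := {ptws lattice d -> R})).
have -> : (fun phi : {ptws lattice d -> R} => \sum_(y <- x :: s) phi y) =
    (fun phi : {ptws lattice d -> R} => (phi x : R) + \sum_(y <- s) phi y).
  by apply/funext => phi; rewrite big_cons.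
apply: (@real_continuousD R {ptws lattice d -> R}) => //.
exact: (@proj_continuous (lattice d) (fun=> R) x).
Qed.

(** A continuous function of the sum between the indicators of [a + 1, +oo[ and
[a, +oo[ carries the bound to the limit. *)
Lemma weak_tail (P : nat -> probability Om R) mu s (a b : R) :
    weak_cvg P mu ->
    (forall n, (P n [set phi | a <= \sum_(x <- s) phi x])%R <= b%:E)%E ->
  (mu [set phi | a + 1 <= \sum_(x <- s) phi x]%R <= b%:E)%E.
Proof.
move=> Pmu Pb.
pose f (phi : {ptws lattice d -> R}) : R :=
  Num.min 1 (Num.max 0 (\sum_(x <- s) phi x - a)).
have f01 phi : 0 <= f phi <= 1.
  by rewrite /f le_min ler01 le_max lexx ge_min lexx.
have cf : continuous f.
  by apply: (@clamp_continuous R {ptws lattice d -> R}); exact: spins_continuous.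
have mf : measurable_fun setT (f : Om -> R).
  apply: measurable_minr => //; apply: measurable_maxr => //.
  by apply: measurable_funB => //; exact: measurable_fun_spins.
have up (Q : probability Om R) :
    (\int[Q]_phi (f phi)%:E <= Q [set phi | a <= \sum_(x <- s) phi x]%R)%E.
  have mA := measurable_sum_ge s a.
  rewrite -[X in Q X]setIT -integral_indic//.
  apply: ge0_le_integral => //.
  - by move=> phi _; rewrite lee_fin; case/andP: (f01 phi).
  - exact/measurable_EFinP.
  - by apply/measurable_EFinP; exact: measurable_indic.
  move=> phi _; rewrite lee_fin indicE.
  case: (boolP (phi \in _)) => [_|]; first by case/andP: (f01 phi).
  move/negP => h; rewrite /f ge_min; apply/orP; right.
  rewrite ge_max lexx subr_le0 leNgt; apply/negP => /ltW h'.
  by apply: h; rewrite inE.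
have lo : (mu [set phi | a + 1 <= \sum_(x <- s) phi x]%R <= \int[mu]_phi (f phi)%:E)%E.
  have mA := measurable_sum_ge s (a + 1).
  rewrite -[X in mu X]setIT -integral_indic//.
  apply: ge0_le_integral => //.
  - by apply/measurable_EFinP; exact: measurable_indic.
  - exact/measurable_EFinP.
  move=> phi _; rewrite lee_fin indicE.
  case: (boolP (phi \in _)) => [|_]; last by case/andP: (f01 phi).
  by rewrite inE /= => h; rewrite /f le_min lexx le_max lerBrDl h orbT.
apply: (le_trans lo); apply: (cvge_le _ (Pmu f cf _)).
  by apply: nearW => n; apply: le_trans (Pb n); exact: up.
by exists 1 => phi; case/andP: (f01 phi) => f0 f1; rewrite ger0_norm.
Qed.

(** There are countably many paths. *)
Lemma measurable_connected_above (h : R) (x y : lattice d) :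
  measurable (connected_above G h x y : set Om).
Proof.
rewrite (_ : connected_above G h x y = \bigcup_(zp : lattice d * seq (lattice d))
   (if [&& path (edge G) zp.1 zp.2, x \in zp.1 :: zp.2 & y \in zp.1 :: zp.2] then
     [set phi : Om | forall w, w \in zp.1 :: zp.2 -> h <= phi w] else set0)).
  apply: countable_bigcupT_measurable => [|zp]; first exact: countableP.
  by case: ifP => // _; exact: measurable_all_above.
apply/seteqP; split => [phi [z [p [pp hp xp yp]]]|phi [[z p] _] /=].
  by exists (z, p) => //=; rewrite pp xp yp.
by case: ifP => // /and3P[pp xp yp] hp; exists z, p.
Qed.

Lemma measure_union_le mu (h b : R) (L : seq (seq (lattice d))) :
    (forall s, s \in L -> (mu [set phi | forall w, w \in s -> h <= phi w]%R <= b%:E)%E) ->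
  measurable [set phi : Om | exists2 s, s \in L & forall w, w \in s -> h <= phi w] /\
  (mu [set phi | exists2 s, s \in L & forall w, w \in s -> (h <= phi w)%R] <=
   ((size L)%:R * b)%:E)%E.
Proof.
elim: L => [|s L IH] Lb.
  rewrite (_ : [set phi | _] = set0); first by rewrite measure0 mul0r.
  by apply/seteqP; split => // phi [].
have [|mL muL] := IH; first by move=> t tL; apply: Lb; rewrite inE tL orbT.
have ms := measurable_all_above h s.
rewrite (_ : [set phi | _] = [set phi : Om | forall w, w \in s -> h <= phi w] `|`
  [set phi : Om | exists2 s, s \in L & forall w, w \in s -> h <= phi w]).
  split; first exact: measurableU.
  apply: le_trans (measureU2 _ _ _) _ => //.
  rewrite /= -natr1 mulrDl mul1r addrC EFinD leeD//.
  by apply: Lb; rewrite mem_head.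
apply/seteqP; split => phi /=.
  move=> [t]; rewrite inE => /orP[/eqP ->|tL] H; [by left|by right; exists t].
by move=> [H|[t tL H]]; [exists s|exists t] => //; rewrite inE ?eqxx ?tL ?orbT.
Qed.

(** The part of the path between its visits to x and y, started from whichever is
visited first. *)
Lemma connected_above_path (h : R) x y (phi : Om) :
  connected_above G h x y phi ->
  exists z w p, [/\ (z == x) && (w == y) || (z == y) && (w == x), path (edge G) z p,
    w \in z :: p & forall v, v \in z :: p -> h <= phi v].
Proof.
move=> [z [p [pp hp xp yp]]].
case/splitPl: xp pp hp yp => p1 p2 lx; rewrite cat_path lx => /andP[pp1 pp2] hp.
rewrite -cat_cons mem_cat => /orP[yp|yp]; last first.
  exists x, y, p2; split => //; rewrite ?eqxx// ?inE ?yp ?orbT// => v.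
  rewrite inE => /orP[/eqP ->|vp]; apply: hp; rewrite -cat_cons mem_cat ?vp ?orbT//.
  by rewrite -lx mem_last.
case/splitPl: yp lx pp1 hp => p3 p4 ly; rewrite last_cat ly => lx.
rewrite cat_path ly => /andP[_ pp4] hp.
exists y, x, p4; split => //; rewrite ?eqxx ?orbT//.
  by rewrite -lx mem_last.
move=> v; rewrite inE => /orP[/eqP ->|vp]; apply: hp.
  by rewrite -cat_cons mem_cat -cat_cons mem_cat -ly mem_last.
by rewrite -cat_cons mem_cat -cat_cons mem_cat vp orbT.
Qed.

End infinite_volume.

Lemma scale_exists r L : exists n, (tree_radius r n <= L < tree_radius r n.+1)%N.
Proof.
have ge n : (n <= tree_radius r n)%N.
  elim: n => //= n IH; rewrite -add1n leq_add// (leq_trans _ (leq_addr _ _))//.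
  by rewrite muln_gt0 expn_gt0 addn_gt0 orbT.
have ex : exists n, (L < tree_radius r n.+1)%N by exists L; exact: ge.
case: (ex_minnP ex) => n Ln nmin; exists n; rewrite Ln andbT.
case: n nmin {Ln} => // n nmin.
by rewrite leqNgt; apply/negP => /nmin; rewrite ltnn.
Qed.

Theorem theorem4p4 (R : realType) (d : nat) (G : {fset lattice d})
    (c0 alpha : R) (mu : probability (Omega R d) R) :
  (3 <= d)%N -> admissible_steps G -> 1 <= c0 -> 0 < alpha ->
  gibbs_class G c0 alpha mu ->
  (h_plus G mu < +oo)%E.
Proof.
move=> d3 admG c01 _ [V admV [A [P [_ _ _ gibbs weak]]]].
have c00 : 0 < c0 by apply: lt_le_trans c01.
have [K reachK] := reach_linf admG.
pose r := (\max_(g <- G) linf g)%N.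
have Gr g : g \in G -> (linf g <= r)%N.
  by move=> gG; rewrite /r (big_rem g)//= leq_maxl.
pose kap := tail_rate c0 K.
pose base : R := (tree_base (d := d) r)%:R.
have base0 : 0 < base.
  by rewrite ltr0n expn_gt0 muln_gt0 addn_gt0 orbT.
(* kap / 2 pays for the exponential moment and ln base for the entropy; of the
   last two units, one pays for the shift by 1 and one leaves exp(- 2^n). *)
pose h := kap / 2 + ln base + 2.
(* [Lam * 8 ^ n] bounds the graph distance of x and y at scale n. *)
pose Lam : R := 8 * (K.+1)%:R * (2 * r + 3)%:R.
have Lam0 : 0 < Lam by rewrite !mulr_gt0// ltr0n addn_gt0 orbT.
apply: (@le_lt_trans _ _ h%:E); last by rewrite ltry.
apply: ereal_inf_lbound; exists h => //.
exists 2, (Lam^-1 `^ 3^-1), 3^-1; split => //.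
  by rewrite powR_gt0// invr_gt0.
move=> x y.
have [n /andP[nL Ln]] := scale_exists r (linf (y - x)).
have tail z s : s \in trees r n z ->
    (mu [set phi | forall w, w \in s -> h <= phi w]%R <=
     (expR (kap / 2 * 2 ^+ n - h * 2 ^+ n + 1))%:E)%E.
  move=> sT; have ss := size_trees sT.
  (* The shift by 1 is the one lost in [weak_tail]. *)
  apply: (@le_trans _ _ (mu [set phi | (h * 2 ^+ n - 1) + 1 <= \sum_(x <- s) phi x]%R)).
    apply: le_measure; rewrite ?inE.
    - exact: measurable_all_above.
    - exact: measurable_sum_ge.
    move=> phi /= hphi; rewrite subrK.
    have -> : h * 2 ^+ n = \sum_(w <- s) h.
      by rewrite big_const_seq count_predT iter_addr_0 ss -[RHS]mulr_natr natrX.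
    by rewrite big_seq [leRHS]big_seq; apply: ler_sum => w ws; exact: hphi.
  apply: (weak_tail weak) => m.
  have sparse k z' : (count (fun w => linf (z' - w)%R < 8 ^ k) s <= 2 ^ k)%N.
    exact: trees_sparse sT.
  apply: le_trans (gibbs_tail admG c00 admV reachK d3 sparse _ (gibbs m)) _.
  by rewrite lee_fin ler_expR ss natrX -/kap opprB; lra.
have tails s : s \in trees r n x ++ trees r n y ->
    (mu [set phi | forall w, w \in s -> h <= phi w]%R <=
     (expR (kap / 2 * 2 ^+ n - h * 2 ^+ n + 1))%:E)%E.
  by rewrite mem_cat => /orP[]; exact: tail.
have [mU muU] := measure_union_le tails.
apply: (@le_trans _ _ (mu [set phi | exists2 s, s \in trees r n x ++ trees r n y &
    forall w, w \in s -> (h <= phi w)%R])).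
  apply: le_measure; rewrite ?inE//; first exact: measurable_connected_above.
  move=> phi /connected_above_path[z [w [p [zw pp wp hp]]]].
  have zwD : (tree_radius r n <= linf (w - z))%N.
    by case/orP: zw => /andP[/eqP -> /eqP ->]//; rewrite linf_distC.
  have [s sT sp] := trees_cover Gr pp wp zwD.
  exists s; last by move=> v /sp; exact: hp.
  rewrite mem_cat.
  by case/orP: zw sT => /andP[/eqP -> _] ->; rewrite ?orbT.
apply: (le_trans muU); rewrite lee_fin.
pose N : R := 2 ^+ n.
have N1 : 1 <= N by rewrite exprn_ege1 ?ler1n.
apply: (@le_trans _ _ (2 * expR (- N))).
  apply: (@le_trans _ _ (2 * base ^+ (2 ^ n) * expR (kap / 2 * N - h * N + 1))).
    apply: ler_wpM2r; first exact: expR_ge0.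
    rewrite size_cat natrD mulr_natl mulr2n /base -natrX.
    by apply: lerD; rewrite ler_nat size_trees_le.
  rewrite -mulrA ler_pM2l// -[base]lnK ?posrE// -expRM_natl -expRD ler_expR natrX -/N.
  rewrite /h; nra.
rewrite ler_pM2l// ler_expR lerN2.
have gd : (gdist G x y)%:R <= Lam * 8 ^+ n.
  have [t [tG ts yx]] := reachK (y - x).
  have /gdistP[_ gs] : walk G (size t) x y by apply/walk_steps; exists t.
  apply: (@le_trans _ _ (8 * K.+1 * (2 * r + 3) * 8 ^ n)%N%:R); last first.
    by rewrite !natrM natrX.
  rewrite ler_nat (leq_trans gs)// (leq_trans ts)//.
  have := tree_radius_le r n.+1; have := leq_trans (ltnW Ln) (leqnn _).
  rewrite expnS.
  move: (linf _) (tree_radius r n.+1) (8 ^ n)%N (2 * r + 3)%N => a b c e ab h7.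
  have : (K * a <= K * b)%N by rewrite leq_mul2l ab orbT.
  nia.
rewrite -powRM ?invr_ge0 ?ler0n ?(ltW Lam0)//.
have -> : N = (8 ^+ n) `^ 3^-1.
  have -> : 8 ^+ n = N `^ 3%:R :> R.
    rewrite powR_mulrn ?exprn_ge0 ?ler0n// /N -exprM mulnC exprM; congr (_ ^+ _); ring.
  by rewrite -powRrM mulfV ?pnatr_eq0// powRr1// exprn_ge0.
apply: ge0_ler_powR; rewrite ?nnegrE ?invr_ge0 ?exprn_ge0//.
  by rewrite mulr_ge0// invr_ge0 ltW.
by rewrite mulrC ler_pdivrMr// mulrC.
Qed.
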